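(* Let $q$ be a nonzero complex number with $|q|<1$. Let $t,m\in\mathbb{Z}$ with $t\geq1$ and $1-t\leq m\leq t$. For generic $x$ (that is, $x\in\mathbb{C}\setminus\{0\}$ not an integral power of $q$), we have $$\begin{aligned}W_t^{(m)}(x;q)=\;&\frac{(1-x)q^{1-m-2t^2}}{(q)_\infty^2\,\Theta(x;q)}\sum_{k=0}^{4t^2-2}(-1)^{k+1}q^{\binom{k+1}{2}+k}\,f_{1,2t,1}\bigl(q^{t-m+2-4t^2+k},\,q;q\bigr)\\&\times\Bigl(f_{1,4t^2-1,4t^2(4t^2-1)}\bigl(x^{-1}q^{k+1},-q^{8t^4-m+4t^2k};q\bigr)+f_{1,4t^2-1,4t^2(4t^2-1)}\bigl(xq^{k+1},-q^{8t^4-m+4t^2k};q\bigr)\Bigr)\\&-\frac{1}{(xq)_\infty(q/x)_\infty}.\end{aligned}$$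
   Context: Notation: $(a)_n=(a;q)_n=\prod_{k=1}^{n}(1-aq^{k-1})$ for $n\in\mathbb{N}\cup\{\infty\}$; in particular $(q)_\infty=\prod_{k\ge1}(1-q^k)$. The theta function is $\Theta(x;q)=(x)_\infty(q/x)_\infty(q)_\infty=\sum_{n\in\mathbb{Z}}(-1)^nq^{\binom n2}x^n$. Set $\mathrm{sg}(r)=1$ if $r\ge0$ and $\mathrm{sg}(r)=-1$ if $r<0$, and $\mathrm{sg}(r,s)=\frac{\mathrm{sg}(r)+\mathrm{sg}(s)}{2}$. For positive integers $a,b,c$ the Hecke-type double sum is $$f_{a,b,c}(x,y;q)=\sum_{r,s\in\mathbb{Z}}\mathrm{sg}(r,s)(-1)^{r+s}x^ry^sq^{a\binom r2+brs+c\binom s2}.$$ Here $\binom{n}{2}=n(n-1)/2$ for every integer $n$. Define $$h_{t,m}(x;q)=\left(\sum_{r,s\ge0}-\sum_{r,s<0}\right)\frac{(-1)^{r+s}q^{\binom{r+1}{2}+2trs+\binom{s+1}{2}+(t-m)r}(1+q^{2mr})}{1-xq^r},$$ $$W_t^{(m)}(x;q)=\frac{(1-x)}{(q)_\infty^2}\,h_{t,m}(x;q)-\frac{1}{(xq)_\infty(q/x)_\infty}.$$ *)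

(* Defs.v *)
From mathcomp Require Export all_boot all_order all_algebra.
From mathcomp Require Export finmap.
From mathcomp Require Export all_classical all_reals all_analysis.
From mathcomp Require Export complex.

Set Implicit Arguments.
Unset Strict Implicit.
Unset Printing Implicit Defensive.

Import Order.TTheory GRing.Theory Num.Theory.
Import numFieldNormedType.Exports.

Local Open Scope classical_set_scope.
Local Open Scope ring_scope.

(* The definitions are over an arbitrary [K : numFieldType], which carries the
   topology of its norm; they are meant for [K := R[i]] with [R : realType]. *)

Definition finite_subsets (I : choiceType) : set_system {fset I} :=
  filter_from [set: {fset I}] (fun A => [set B | fsubset A B]).
Arguments finite_subsets I : clear implicits.

Global Instance finite_subsets_filter (I : choiceType) :
  ProperFilter (finite_subsets I).
Proof.
apply: filter_from_proper; last by move=> A _; exists A => /=.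
apply: filter_from_filter; first by exists fset0.
move=> A B _ _; exists (fsetU A B) => // D /= ABD.
by split; apply: fsubset_trans ABD; [exact: fsubsetUl | exact: fsubsetUr].
Qed.

(* Unconditional sum of the family [F] over the indices satisfying [P]: the
   limit of its finite partial sums along the finite subsets of [I] ordered by
   inclusion. In a complex setting this is the absolutely convergent sum. *)
Definition usum (K : numFieldType) (I : choiceType) (P : pred I) (F : I -> K)
  : K :=
  lim ((fun A : {fset I} => \sum_(i <- A | P i) F i) @ finite_subsets I).

Definition qpoch (K : numFieldType) (a q : K) (n : nat) : K :=
  \prod_(1 <= k < n.+1) (1 - a * q ^+ k.-1).

Definition qpochoo (K : numFieldType) (a q : K) : K :=
  lim (qpoch a q n @[n --> \oo]).

Definition theta (K : numFieldType) (x q : K) : K :=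
  qpochoo x q * qpochoo (q / x) q * qpochoo q q.

(* Since n(n-1) is even, the integer quotient is exact, also for n < 0. *)
Definition binz (n : int) : int := ((n * (n - 1)) %/ 2)%Z.

(* Unlike [sgz], this sign takes the value 1 at 0. *)
Definition sg (r : int) : int := if 0 <= r then 1 else -1.

Definition sg2 (K : numFieldType) (r s : int) : K :=
  (sg r + sg s)%:~R / 2.

Definition hecke (K : numFieldType) (a b c : int) (x y q : K) : K :=
  usum xpredT (fun p : int * int => let: (r, s) := p in
    sg2 K r s * (-1) ^ (r + s) * x ^ r * y ^ s
      * q ^ (a * binz r + b * r * s + c * binz s)).

Definition h_term (K : numFieldType) (t m : int) (x q : K) (p : int * int)
  : K :=
  let: (r, s) := p in
  (-1) ^ (r + s)
    * q ^ (binz (r + 1) + 2 * t * r * s + binz (s + 1) + (t - m) * r)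
    * (1 + q ^ (2 * m * r)) / (1 - x * q ^ r).

Definition h (K : numFieldType) (t m : int) (x q : K) : K :=
  usum (fun p : int * int => (0 <= p.1) && (0 <= p.2)) (h_term t m x q)
  - usum (fun p : int * int => (p.1 < 0) && (p.2 < 0)) (h_term t m x q).

Definition W (K : numFieldType) (t m : int) (x q : K) : K :=
  (1 - x) / qpochoo q q ^+ 2 * h t m x q
  - 1 / (qpochoo (x * q) q * qpochoo (q / x) q).

(* Main.v *)
Require Import Defs.
From mathcomp Require Import ring zify.

Import Order.TTheory GRing.Theory Num.Theory.
Import numFieldNormedType.Exports.
Local Open Scope ring_scope.

Set Implicit Arguments.
Unset Strict Implicit.
Unset Printing Implicit Defensive.

(* Write E(r,s) = C(r+1,2) + 2trs + C(s+1,2), let F(b) be the sum over the cone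
   {r,s >= 0} minus {r,s < 0} of (-1)^(r+s) q^(E(r,s) + br), that is
   f_{1,2t,1}(q^(b+1), q; q), and let g_a(x) be the sum over the same cone of
   (-1)^(r+s) q^(E(r,s) + ar) / (1 - x q^r).
   Then h_{t,m}(x) = g_{t-m}(x) + g_{t+m}(x), and (r,s) -> (-r,-1-s) gives
   g_{t+m}(x) = - x^-1 g_{t-m}(1/x); as Theta(1/x) = - x^-1 Theta(x), it is
   enough to expand Theta(x) g_a(x) for a = t - m.
   For every integer r, Theta(x) / (1 - x q^r) is the sum over the cone
   {n <= 0, i >= 0} minus {n >= 1, i < 0} of
   (-1)^(n+i) q^(C(n-i,2) + ir) x^n. Since 0 <= a <= 2t - 1 the resulting
   fourfold sum converges absolutely, and exchanging the summations gives
   Theta(x) g_a(x) = sum over (n,i) of (-1)^(n+i) q^(C(n-i,2)) x^n F(a+i).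
   The substitution (r,s) -> (r+l, s-2tl) relates F(b) to F(b - (4t^2-1) l),
   because the strips by which the cone changes carry theta series at powers of
   q, which vanish. Splitting i = k + (4t^2-1) s and n = -r thus turns each
   residue class k into a multiple of f_{1,4t^2-1,4t^2(4t^2-1)}. *)

(** * Unconditional sums *)

Section UnconditionalSums.
Variable K : numFieldType.
Implicit Types I J : choiceType.

Definition hassum I (F : I -> K) (l : K) := forall e : K, 0 < e ->
  exists A : {fset I}, forall B : {fset I}, fsubset A B ->
    `|l - \sum_(i <- B) F i| < e.

Definition summable I (F : I -> K) :=
  exists M, forall A : {fset I}, \sum_(i <- A) `|F i| <= M.

Lemma hassum_usum I (P : pred I) (F : I -> K) l :
  hassum (fun i => if P i then F i else 0) l -> usum P F = l.
Proof.
move=> Fl; apply: cvg_lim; first exact: norm_hausdorff.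
apply/cvgrPdist_lt => e e0; have [A FA] := Fl _ e0.
by exists A => // B AB; rewrite big_mkcond; exact: FA.
Qed.

Lemma hassum_unique I (F : I -> K) l l' : hassum F l -> hassum F l' -> l = l'.
Proof. by move=> /(@hassum_usum I xpredT) <- /(@hassum_usum I xpredT) <-. Qed.

Lemma hassumD I (F G : I -> K) l l' :
  hassum F l -> hassum G l' -> hassum (fun i => F i + G i) (l + l').
Proof.
move=> Fl Gl e e0; have e20 : 0 < e / 2 by rewrite divr_gt0.
have [A FA] := Fl _ e20; have [B GB] := Gl _ e20.
exists (fsetU A B) => C; rewrite fsubUset => /andP[AC BC].
rewrite big_split/= opprD addrACA [e]splitr.
by rewrite (le_lt_trans (ler_normD _ _))// ltrD ?FA ?GB.
Qed.

Lemma hassumZ I (F : I -> K) c l :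
  hassum F l -> hassum (fun i => c * F i) (c * l).
Proof.
move=> Fl e e0; have c0 : 0 < `|c| + 1 by rewrite ltr_wpDl.
have [A FA] := Fl _ (divr_gt0 e0 c0); exists A => B AB.
rewrite -mulr_sumr -mulrBr normrM.
have := FA _ AB; rewrite ltr_pdivlMr// mulrC; apply: le_lt_trans.
by rewrite ler_wpM2r// lerDl.
Qed.

Lemma hassum_sum I J (s : seq J) (F : J -> I -> K) (g : J -> K) :
  (forall j, hassum (F j) (g j)) ->
  hassum (fun i => \sum_(j <- s) F j i) (\sum_(j <- s) g j).
Proof.
move=> Fg; elim: s => [|j s ih].
  by move=> e e0; exists fset0 => B _;
    rewrite big_nil big1 ?subrr ?normr0// => i _; rewrite big_nil.
rewrite big_cons; have -> : (fun i => \sum_(k <- j :: s) F k i) =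
    (fun i => F j i + \sum_(k <- s) F k i).
  by apply/funext => i; rewrite big_cons.
exact: hassumD.
Qed.

Lemma ler_sum_fset I (F : I -> K) (A B : {fset I}) : (forall i, 0 <= F i) ->
  fsubset A B -> \sum_(i <- A) F i <= \sum_(i <- B) F i.
Proof.
move=> F0 AB; rewrite (big_fsetID _ (mem A) B) /= (_ : [fset x in B | x \in
  A]%fset = A).
  by rewrite lerDl sumr_ge0.
by apply/fsetP => i; rewrite !inE/= andb_idl// => /(fsubsetP AB).
Qed.

Lemma sum_imfset I J (f : J -> I) (F : I -> K) (C : {fset J}) : injective f ->
  \sum_(i <- [fset f j | j in C]%fset) F i = \sum_(j <- C) F (f j).
Proof. by move=> fI; rewrite big_imfset//= => ? ? _ _; exact: fI. Qed.

Lemma fset_preimage I J (f : J -> I) (B : {fset I}) : injective f ->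
  exists C : {fset J}, forall j, (j \in C) = (f j \in B).
Proof.
move=> fI; exists (fset_set (f @^-1` [set` B])%classic) => j.
rewrite in_fset_set ?inE//; last first.
  by apply: finite_preimage => // x y _ _; exact: fI.
by apply/idP/idP => [/set_mem|?]//; rewrite mem_setE.
Qed.

Lemma hassum_inj I J (f : J -> I) (F : I -> K) l : injective f ->
  (forall i, (forall j, f j != i) -> F i = 0) ->
  hassum F l <-> hassum (F \o f) l.
Proof.
move=> fI F0.
have FfE (B : {fset I}) (C : {fset J}) : (forall j, (j \in C) = (f j \in B)) ->
    \sum_(j <- C) (F \o f) j = \sum_(i <- B) F i.
  move=> CB; rewrite -[LHS](sum_imfset F C fI).
  apply/big_fset_incl.
    by apply/fsubsetP => i /imfsetP[j /= jC ->]; rewrite -CB.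
  move=> i iB ni; apply: F0 => j; apply: contraNneq ni => fji.
  by rewrite -fji mem_imfset//= CB fji.
split => Fl e e0; have [A FA] := Fl _ e0.
  have [C AC] := fset_preimage A fI; exists C => B CB.
  pose D := fsetU A [fset f j | j in B]%fset.
  rewrite (FfE D) ?FA ?fsubsetUl// => j.
  rewrite in_fsetU mem_imfset//= orb_idl// -AC; exact: (fsubsetP CB).
exists [fset f j | j in A]%fset => B AB.
have [C CB] := fset_preimage B fI; rewrite -(FfE _ _ CB) FA//.
apply/fsubsetP => j jA; rewrite CB (fsubsetP AB)//.
by rewrite mem_imfset.
Qed.

Lemma hassum_pair I J (F : I * J -> K) (g : I -> K) l :
  hassum F l -> (forall i, hassum (fun j => F (i, j)) (g i)) -> hassum g l.
Proof.
move=> Fl Fg e e0; have e20 : 0 < e / 2 by rewrite divr_gt0.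
have [A FA] := Fl _ e20; exists [fset p.1 | p in A]%fset => B AB.
have [C0 gC] := hassum_sum B Fg e20.
pose C := fsetU C0 [fset p.2 | p in A]%fset.
pose D : {fset I * J} := [fset ((i, j) : I * J) | i : I in B, j : J in C]%fset.
have /FA : fsubset A D.
  apply/fsubsetP => -[i j] ijA; apply/imfset2P; exists i => /=.
    by rewrite (fsubsetP AB)//; apply/imfsetP; exists (i, j).
  exists j => //=; rewrite !inE; apply/orP; right.
  by apply/imfsetP; exists (i, j).
rewrite big_imfset2/=; last by move=> [? ?] [? ?] /= _ _ [-> ->].
rewrite exchange_big/= => lD; have {}gC := gC C (fsubsetUl _ _).
rewrite [e]splitr; apply: le_lt_trans (ltrD lD gC).
by rewrite [X in _ <= _ + X]distrC; exact: ler_distD.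
Qed.

Lemma summable_le I (F G : I -> K) : summable G ->
  (forall i, `|F i| <= `|G i|) -> summable F.
Proof.
move=> [M GM] FG; exists M => A; apply: le_trans (GM A).
by apply: ler_sum => i _; exact: FG.
Qed.

Lemma summableD I (F G : I -> K) :
  summable F -> summable G -> summable (fun i => F i + G i).
Proof.
move=> [M FM] [N GN]; exists (M + N) => A; apply: le_trans (lerD (FM A) (GN A)).
by rewrite -big_split/=; apply: ler_sum => i _; exact: ler_normD.
Qed.

Lemma summableZ I (F : I -> K) c : summable F -> summable (fun i => c * F i).
Proof.
move=> [M FM]; exists (`|c| * M) => A; under eq_bigr do rewrite normrM.
by rewrite -mulr_sumr ler_wpM2l.
Qed.

Lemma summable_inj I J (f : J -> I) (F : I -> K) : injective f ->
  summable F -> summable (F \o f).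
Proof.
move=> fI [M FM]; exists M => A.
by rewrite -[leLHS](sum_imfset (fun i => `|F i|) A fI).
Qed.

Lemma summable_pair I J (u : I -> K) (v : J -> K) :
  summable u -> summable v -> summable (fun p => u p.1 * v p.2).
Proof.
move=> [M uM] [N vN]; exists (M * N) => A.
pose D : {fset I * J} := [fset ((i, j) : I * J) | i : I in [fset p.1 | p in A],
  j : J in [fset p.2 | p in A]]%fset.
have AD : fsubset A D.
  apply/fsubsetP => -[i j] ijA; apply/imfset2P; exists i => /=.
    by apply/imfsetP; exists (i, j).
  by exists j => //; apply/imfsetP; exists (i, j).
apply: le_trans (ler_sum_fset _ AD) _ => //.
rewrite big_imfset2/=; last by move=> [? ?] [? ?] /= _ _ [-> ->].
under eq_bigr do under eq_bigr do rewrite normrM.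
rewrite -big_distrlr/=; apply: ler_pM => //; exact: sumr_ge0.
Qed.

Lemma summable_fin (T : finType) (F : T -> K) : summable F.
Proof.
exists (\sum_(i <- [fset i in T]%fset) `|F i|) => A; apply: ler_sum_fset => //.
by apply/fsubsetP => i _; rewrite !inE.
Qed.

Lemma hassum_fin (T : finType) (F : T -> K) : hassum F (\sum_i F i).
Proof.
move=> e e0; exists [fset i in T]%fset => B TB.
suff -> : \sum_(i <- B) F i = \sum_i F i by rewrite subrr normr0.
apply: perm_big; apply: uniq_perm; rewrite ?fset_uniq ?index_enum_uniq// => i.
by rewrite mem_index_enum; apply: (fsubsetP TB); rewrite !inE.
Qed.

Lemma hassum_le I (F : I -> K) l M : hassum F l ->
  (forall A : {fset I}, \sum_(i <- A) `|F i| <= M) -> `|l| <= M.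
Proof.
move=> Fl FM; have M0 : 0 <= M by have := FM fset0; rewrite big_seq_fset0.
rewrite real_leNgt ?ger0_real//; apply/negP => Ml.
move: (Ml); rewrite -subr_gt0 => /Fl[A /(_ A (fsubset_refl A)) lA].
suff : `|l| - M <= `|l - \sum_(i <- A) F i| by move=> /le_lt_trans /(_ lA);
  rewrite ltxx.
rewrite lerBlDr -{1}[l](subrK (\sum_(i <- A) F i)).
apply: le_trans (ler_normD _ _) _; rewrite lerD2l.
exact: le_trans (ler_norm_sum _ _ _) (FM A).
Qed.

Lemma nat_fset N : exists B : {fset nat}, (forall i, (i \in B) = (i < N)%N) /\
  forall F : nat -> K, \sum_(i <- B) F i = \sum_(i < N) F i.
Proof.
have BN i : (i \in [fset i in iota 0 N]%fset) = (i < N)%N.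
  by rewrite in_fset; change ((i \in iota 0 N) = (i < N)%N); rewrite mem_iota.
exists [fset i in iota 0 N]%fset; split=> // F.
rewrite -(big_mkord xpredT) /index_iota subn0; apply: perm_big.
by apply: uniq_perm; rewrite ?fset_uniq ?iota_uniq// => i; rewrite BN mem_iota.
Qed.

Lemma summable_geometric (r : K) : 0 <= r < 1 -> summable (fun n : nat => r ^+
  n).
Proof.
case/andP => r0 r1; exists (1 - r)^-1 => A;
  have r10 : 0 < 1 - r by rewrite subr_gt0.
pose N := \max_(i <- A) i.
have [B [BN Bs]] := nat_fset N.+1.
apply: le_trans (ler_sum_fset (B := B) _ _) _ => //.
  apply/fsubsetP => i iA; rewrite BN ltnS /N.
  by rewrite (big_fsetD1 i)//= leq_maxl.
rewrite Bs.
under eq_bigr do rewrite ger0_norm ?exprn_ge0//.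
rewrite -(ler_pM2l r10) divff ?gt_eqF//.
by rewrite -[1 - r]opprB mulNr -subrX1 opprB lerBlDr lerDl exprn_ge0.
Qed.

Lemma summable_geometricz (r : K) : 0 <= r < 1 ->
  summable (fun n : int => r ^+ `|n|%N).
Proof.
move=> r01; pose f (n : int) := (n < 0, `|n|%N).
have fI : injective f by move=> m n []; lia.
have := summable_pair (summable_fin (fun _ : bool => 1)) (summable_geometric
  r01).
move=> /(summable_inj fI) [M sM]; exists M => A; apply: le_trans (sM A).
by apply: ler_sum => i _; rewrite /= mul1r.
Qed.

Lemma cvg_hassum_nat (u : nat -> K) l : hassum u l ->
  (\sum_(i < n) u i @[n --> \oo] --> l)%classic.
Proof.
move=> ul; apply/cvgrPdist_lt => e e0; have [A uA] := ul _ e0.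
exists (\max_(i <- A) i).+1 => // n /= An.
have [B [BN <-]] := nat_fset n.
apply: uA; apply/fsubsetP => i iA; rewrite BN.
by apply: leq_trans An; rewrite ltnS (big_fsetD1 i)//= leq_maxl.
Qed.

End UnconditionalSums.

Arguments nat_fset {K} N.

Section Completeness.
Variable R : realType.

Lemma hassum_ge0_real (I : choiceType) (F : I -> R) : (forall i, 0 <= F i) ->
  summable F -> exists l, hassum F l.
Proof.
move=> F0 [M FM]; pose E := [set \sum_(i <- A) F i | A in [set: {fset
  I}]]%classic.
have EM : has_sup E.
  split; first by exists (\sum_(i <- fset0) F i), fset0.
  exists M => _ [A _ <-]; apply: le_trans (FM A).
  by apply: ler_sum => i _; exact: ler_norm.
exists (sup E) => e e0.
have [_ [A _ <-] lA] := sup_adherent e0 EM; exists A => B AB.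
have lB : \sum_(i <- B) F i <= sup E.
  by apply: sup_upper_bound => //; exists B.
rewrite ger0_norm ?subr_ge0// ltrBlDr -ltrBlDl.
exact: lt_le_trans lA (ler_sum_fset F0 AB).
Qed.

Lemma hassum_real (I : choiceType) (F : I -> R) :
  summable F -> exists l, hassum F l.
Proof.
move=> sF; have [l Fl] : exists l, hassum (fun i => `|F i| + F i) l.
  apply: hassum_ge0_real => [i|];
    first by rewrite -lerBlDr sub0r -normrN ler_norm.
  by apply: summableD => //; apply: summable_le sF _ => i; rewrite normr_id.
have [m Fm] : exists l, hassum (fun i => `|F i|) l.
  apply: hassum_ge0_real => //; apply: summable_le sF _ => i;
    by rewrite normr_id.
exists (l + (-1) * m).
rewrite (_ : F = fun i => `|F i| + F i + (-1) * `|F i|); last first.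
  by apply/funext => i; ring.
exact: hassumD (hassumZ _ Fm).
Qed.

Lemma hassum_complex (I : choiceType) (F : I -> R[i]) (l : R) (G : I -> R) :
  hassum G l -> (forall i, F i = (G i)%:C%C) -> hassum F (l%:C%C).
Proof.
move=> Gl FG e e0; have eE : e = (complex.Re e)%:C%C.
  by rewrite RRe_real// ger0_real// ltW.
rewrite eE ltcR in e0; have [A GA] := Gl _ e0; exists A => B AB.
rewrite eE (eq_bigr _ (fun i _ => FG i)) -rmorph_sum -rmorphB/= normc_def/=.
by rewrite expr0n/= addr0 sqrtr_sqr ltcR GA.
Qed.

Lemma complex_summable_hassum (I : choiceType) (F : I -> R[i]) :
  summable F -> exists l, hassum F l.
Proof.
move=> [M FM]; have FR (A : {fset I}) : \sum_(i <- A) `|complex.Re (F i)| <=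
  complex.Re M.
  have : \sum_(i <- A) (`|complex.Re (F i)|)%:C%C <= M.
    by apply: le_trans (FM A); apply: ler_sum => i _; exact: normc_ge_Re.
  by rewrite -rmorph_sum lecE/= => /andP[].
have FI (A : {fset I}) : \sum_(i <- A) `|complex.Im (F i)| <= complex.Re M.
  have : \sum_(i <- A) (`|complex.Im (F i)|)%:C%C <= M.
    apply: le_trans (FM A); apply: ler_sum => i _.
    rewrite normc_def lecR -sqrtr_sqr ler_wsqrtr// lerDr sqr_ge0.
    by [].
  by rewrite -rmorph_sum lecE/= => /andP[].
have [l Gl] := hassum_real (ex_intro _ _ FR).
have [m Gm] := hassum_real (ex_intro _ _ FI).
exists (l%:C%C + 'i%C * m%:C%C).
rewrite (_ : F = fun i => (complex.Re (F i))%:C%C + 'i%C * (complex.Im (F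
  i))%:C%C); last first.
  by apply/funext => i; exact: complexE.
apply: hassumD; first exact: hassum_complex Gl _.
by apply/hassumZ/(hassum_complex Gm).
Qed.

End Completeness.

Section ComplexSums.
Variable R : realType.
Local Notation K := R[i].
Implicit Types I J : choiceType.

Definition tsum I (F : I -> K) := usum xpredT F.

Lemma hassumP I (F : I -> K) : summable F -> hassum F (tsum F).
Proof. by move=> /complex_summable_hassum[l Fl];
  rewrite /tsum (hassum_usum (l := l)). Qed.

Lemma tsumE I (F : I -> K) l : hassum F l -> tsum F = l.
Proof. exact: (hassum_usum (P := xpredT)). Qed.

Lemma tsumD I (F G : I -> K) : summable F -> summable G ->
  tsum (fun i => F i + G i) = tsum F + tsum G.
Proof. by move=> /hassumP Fl /hassumP Gl; apply/tsumE/hassumD. Qed.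

Lemma tsumZ I (F : I -> K) c : summable F -> tsum (fun i => c * F i) = c * tsum
  F.
Proof. by move=> /hassumP Fl; apply/tsumE/hassumZ. Qed.

Lemma tsum_inj I J (f : J -> I) (F : I -> K) : injective f -> summable F ->
  (forall i, (forall j, f j != i) -> F i = 0) -> tsum (F \o f) = tsum F.
Proof. by move=> fI /hassumP Fl F0; apply/tsumE;
  move/(hassum_inj _ fI F0): Fl. Qed.

Lemma tsum_bij I J (f : J -> I) (F : I -> K) : bijective f -> summable F ->
  tsum (F \o f) = tsum F.
Proof.
move=> [g fK gK] sF; apply: tsum_inj => //; first exact: can_inj fK.
by move=> i /(_ (g i)); rewrite gK eqxx.
Qed.

Lemma summable_row I J (F : I * J -> K) i : summable F ->
  summable (fun j => F (i, j)).
Proof.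
by apply: (@summable_inj _ _ _ (fun j => (i, j)) F) => ? ? [].
Qed.

Lemma tsum_pair I J (F : I * J -> K) : summable F ->
  tsum (fun i => tsum (fun j => F (i, j))) = tsum F.
Proof.
move=> sF; apply/tsumE/(hassum_pair (hassumP sF)) => i.
exact/hassumP/summable_row.
Qed.

Lemma tsum_swap I J (F : I * J -> K) : summable F ->
  tsum (fun i => tsum (fun j => F (i, j))) =
  tsum (fun j => tsum (fun i => F (i, j))).
Proof.
move=> sF; rewrite tsum_pair//.
pose f (p : J * I) := (p.2, p.1).
have fB : bijective f by exists (fun p => (p.2, p.1)) => -[].
have sG := summable_inj (bij_inj fB) sF.
by rewrite -(tsum_bij fB sF) -(tsum_pair sG).
Qed.

Lemma tsum_fin (T : finType) (F : T -> K) : tsum F = \sum_i F i.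
Proof. exact/tsumE/hassum_fin. Qed.

Lemma ler_norm_tsum I (F : I -> K) M :
  (forall A : {fset I}, \sum_(i <- A) `|F i| <= M) -> `|tsum F| <= M.
Proof. by move=> FM; apply: hassum_le (FM); apply/hassumP; exists M. Qed.

Lemma summable_tail I (F : I -> K) (e : K) : summable F -> 0 < e ->
  exists A : {fset I}, forall B : {fset I}, fdisjoint A B ->
    \sum_(i <- B) `|F i| < e.
Proof.
move=> [M FM] e0; have : summable (fun i => `|F i|).
  by exists M => A; under eq_bigr do rewrite normr_id.
move=> /hassumP; set l := tsum _ => Fl;
  have e20 : 0 < e / 2 by rewrite divr_gt0.
have [A FA] := Fl _ e20; exists A => B AB.
have := ltrD (FA _ (fsubset_refl A)) (FA _ (fsubsetUl A B)).
rewrite -splitr; apply: le_lt_trans.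
have -> : \sum_(i <- (A `|` B)%fset) `|F i| =
    \sum_(i <- A) `|F i| + \sum_(i <- B) `|F i|.
  rewrite (big_fsetID _ (mem A))/=; congr (_ + _); apply: eq_fbigl => i.
    by rewrite !inE; case: (i \in A); rewrite ?andbF ?orbT.
  rewrite !inE; have := fdisjointP AB i; case: (i \in A) => //=.
    by move=> /(_ isT) /negPf ->.
  by rewrite andbT.
set a := \sum_(i <- A) _; set b := \sum_(i <- B) _.
have b0 : 0 <= b by exact: sumr_ge0.
rewrite -[leLHS](ger0_norm b0).
have -> : `|b| = `|(l - a) - (l - (a + b))| by congr (`|_|); ring.
exact: ler_normB.
Qed.

Lemma cvg_partial (u : nat -> K) : summable u ->
  (\sum_(i < n) u i @[n --> \oo] --> tsum u)%classic.
Proof. by move=> /hassumP; exact: cvg_hassum_nat. Qed.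

Lemma summable_nat_tail (u : nat -> K) (e : K) : summable u -> 0 < e ->
  exists N, forall n, \sum_(i < n) `|u (N + i)%N| < e.
Proof.
move=> su e0; have [A uA] := summable_tail su e0.
pose N := (\max_(i <- A) i).+1; exists N => n.
have [B [BN Bs]] := nat_fset (K := K) n;
  rewrite -(Bs (fun i => `|u (N + i)%N|)).
have NI : injective (addn N) by move=> i j; lia.
rewrite -(sum_imfset (fun i => `|u i|) B NI); apply: uA.
apply/fdisjointP => i iA; apply/negP => /imfsetP[j _ ij].
have : (i < N)%N by rewrite ltnS (big_fsetD1 i)//= leq_maxl.
by rewrite ij; lia.
Qed.

Lemma summable_small (u : nat -> K) (e : K) : summable u -> 0 < e ->
  exists N, forall n, (N <= n)%N -> `|u n| < e.
Proof.
move=> su e0; have [N uN] := summable_nat_tail su e0; exists N => n Nn.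
have := uN (n - N).+1; rewrite big_ord_recr/= subnKC//.
by apply: le_lt_trans; rewrite lerDr sumr_ge0.
Qed.

Lemma norm_prod1D (u : nat -> K) n :
  \sum_(i < n) `|u i| <= 1 / 2 ->
  `|\prod_(i < n) (1 + u i)| <= 1 + 2 * \sum_(i < n) `|u i| /\
  1 - \sum_(i < n) `|u i| <= `|\prod_(i < n) (1 + u i)|.
Proof.
elim: n => [|n ih]; first by rewrite !big_ord0 normr1 mulr0 addr0 subr0.
rewrite !big_ord_recr/= normrM.
set S := \sum_(i < n) _; set P := `|\prod_(i < n) _|; set v := u n => Sv.
have S0 : 0 <= S by exact: sumr_ge0.
have v0 : 0 <= `|v| by [].
have [|PS SP] := ih.
  by apply: le_trans Sv; rewrite lerDl.
have P0 : 0 <= P by exact: normr_ge0.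
have vu : `|1 + v| <= 1 + `|v| by apply: le_trans (ler_normD _ _) _;
  rewrite normr1.
have vl : 1 - `|v| <= `|1 + v|.
  by rewrite lerBlDr -{1}(normr1 K) -{1}(addrK v 1) ler_normB.
have S12 : S <= 1 / 2 by apply: le_trans Sv; rewrite lerDl.
have h1 : 1 / 2 <= 1 :> K by rewrite ler_pdivrMr// mul1r ler1n.
have S1 : 0 <= 1 - S by rewrite subr_ge0 (le_trans S12).
have v1 : 0 <= 1 - `|v| by rewrite subr_ge0 (le_trans _ (le_trans Sv h1))//
  lerDr.
split.
  apply: le_trans (ler_pM P0 (normr_ge0 _) PS vu) _.
  have -> : 1 + 2 * (S + `|v|) = (1 + 2 * S) * (1 + `|v|) + 2 * `|v| * (1 / 2 -
    S).
    by field.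
  by rewrite lerDl mulr_ge0 ?subr_ge0// mulr_ge0.
apply: le_trans (ler_pM S1 v1 SP vl).
have -> : (1 - S) * (1 - `|v|) = 1 - (S + `|v|) + S * `|v| by ring.
by rewrite lerDl mulr_ge0.
Qed.

End ComplexSums.

(** * Infinite q-Pochhammer products *)

Section QPochhammer.
Variable R : realType.
Local Notation K := R[i].

Section QPoch.
Variables q a : K.
Hypothesis q1 : `|q| < 1.

Lemma qpochE n : qpoch a q n = \prod_(i < n) (1 + - (a * q ^+ i)).
Proof. by rewrite /qpoch big_add1 big_mkord. Qed.

Lemma qpochD m n : qpoch a q (m + n) = qpoch a q m * qpoch (a * q ^+ m) q n.
Proof.
rewrite /qpoch !big_add1 !big_mkord big_split_ord/=; congr (_ * _).
by apply: eq_bigr => i _; rewrite exprD mulrA.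
Qed.

Lemma summable_aq : summable (fun i => - (a * q ^+ i)).
Proof.
have := summableZ a (summable_geometric (r := `|q|) _).
rewrite normr_ge0 q1 => /(_ isT) sq; apply: summable_le sq _ => i.
by rewrite normrN !normrM !normrX normr_id.
Qed.

End QPoch.

Lemma qpoch_tail (a q : K) : `|q| < 1 -> exists N, forall n,
  1 / 2 <= `|qpoch (a * q ^+ N) q n| <= 2.
Proof.
move=> q1; have h2 : 0 < 1 / 2 :> K by rewrite divr_gt0.
have [N uN] := summable_nat_tail (summable_aq a q1) h2; exists N => n.
have {}uN : \sum_(i < n) `|- (a * q ^+ N * q ^+ i)| <= 1 / 2.
  rewrite (le_trans _ (ltW (uN n)))//; apply: ler_sum => i _.
  by rewrite exprD mulrA.
rewrite qpochE; have [up lo] := norm_prod1D (u := fun i => - (a * q ^+ N * q ^+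
  i)) uN.
apply/andP; split.
  by apply: le_trans lo; rewrite lerBrDr {3}[1]splitr lerD2l.
have -> : 2 = 1 + 2 * (1 / 2) :> K by field.
by apply: le_trans up _; rewrite lerD2l ler_pM2l.
Qed.

Lemma qpoch_bounded (a q : K) : `|q| < 1 -> exists M, forall n, `|qpoch a q n|
  <= M.
Proof.
move=> q1; have [N aN] := qpoch_tail a q1.
exists (\sum_(i < N) `|qpoch a q i| + `|qpoch a q N| * 2) => n.
have [nN|Nn] := ltnP n N.
  by rewrite (bigD1 (Ordinal nN))//= -addrA lerDl addr_ge0 ?sumr_ge0.
rewrite -(subnKC Nn) qpochD normrM ler_wpDl ?sumr_ge0//.
by rewrite ler_wpM2l//; case/andP: (aN (n - N)%N).
Qed.

Lemma cvg_qpoch (a q : K) : `|q| < 1 -> (qpoch a q n @[n --> \oo] --> qpochoo a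
  q)%classic.
Proof.
move=> q1; suff [l al] : exists l : (K : numFieldType), (qpoch a q n @[n -->
  \oo] --> l)%classic.
  by rewrite /qpochoo (cvg_lim _ al)//; exact: norm_hausdorff.
pose u n := - (a * q ^+ n) * qpoch a q n.
have su : summable u.
  have [M aM] := qpoch_bounded a q1.
  apply: summable_le (summableZ M (summable_aq a q1)) _ => i.
  have M0 : 0 <= M := le_trans (normr_ge0 _) (aM 0%N).
  by rewrite /u !normrM mulrC (ger0_norm M0) ler_wpM2r.
have -> : qpoch a q = fun n => 1 + \sum_(i < n) u i.
  apply/funext => n; rewrite qpochE; elim: n => [|n ih].
    by rewrite !big_ord0 addr0.
  by rewrite !big_ord_recr/= addrA -ih /u qpochE; ring.
exists (1 + tsum u); apply: cvgD; first exact: cvg_cst.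
exact: cvg_partial.
Qed.

Lemma qpochoo_neq0 (a q : K) : `|q| < 1 -> (forall n, a * q ^+ n != 1) ->
  qpochoo a q != 0 /\ exists M, forall n, `|(qpoch a q n)^-1| <= M.
Proof.
move=> q1 aq; have p0 n : qpoch a q n != 0.
  rewrite qpochE; apply/prodf_neq0 => i _; by rewrite subr_eq0 eq_sym.
have [N aN] := qpoch_tail a q1; pose c := `|qpoch a q N| / 2.
have c0 : 0 < c by rewrite divr_gt0 ?normr_gt0.
have lo n : (N <= n)%N -> c <= `|qpoch a q n|.
  move=> Nn; rewrite -(subnKC Nn) qpochD normrM /c.
  by rewrite ler_wpM2l// -[_^-1]mul1r; case/andP: (aN (n - N)%N).
split.
  apply/eqP => a0; have := cvg_qpoch (a := a) q1; rewrite a0.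
  move=> /cvgrPdist_lt /(_ _ c0) [n _ /(_ (maxn n N))/=].
  rewrite leq_maxl sub0r normrN => /(_ isT) ac.
  by have := le_lt_trans (lo _ (leq_maxr n N)) ac; rewrite ltxx.
exists (\sum_(i < N) `|(qpoch a q i)^-1| + c^-1) => n.
have [nN|Nn] := ltnP n N.
  rewrite (bigD1 (Ordinal nN))//= -addrA lerDl addr_ge0 ?sumr_ge0//.
  by rewrite invr_ge0 ltW.
by rewrite ler_wpDl ?sumr_ge0// normfV lef_pV2 ?posrE ?normr_gt0 ?lo.
Qed.

End QPochhammer.

Section PowerBounds.
Variable R : realType.
Local Notation K := R[i].
Implicit Types I J : choiceType.

Lemma tsum_single I (F : I -> K) i : (forall j, j != i -> F j = 0) ->
  summable F -> tsum F = F i.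
Proof.
move=> Fi sF; rewrite -(@tsum_inj _ _ _ (fun _ : unit => i) F)//; last first.
- by move=> j /(_ tt); rewrite eq_sym; exact: Fi.
- by move=> [] [].
by rewrite tsum_fin (bigD1 tt)//= big1 ?addr0// => -[].
Qed.

Lemma tannery I (e : nat -> I -> K) (D : I -> K) (M : K) :
  summable D -> (forall n j, `|e n j| <= M) ->
  (forall j d, 0 < d -> exists N, forall n, (N <= n)%N -> `|e n j| < d) ->
  forall d, 0 < d ->
    exists N, forall n, (N <= n)%N -> `|tsum (fun j => e n j * D j)| < d.
Proof.
move=> sD eM e0.
have M0 : 0 <= `|M| + 1 by rewrite addr_ge0.
have {}eM n j : `|e n j| <= `|M| + 1.
  rewrite ler_wpDr// (le_trans (eM n j))// ger0_norm//.
  exact: le_trans (normr_ge0 _) (eM n j).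
have fin (s : seq I) (d : K) : 0 < d -> exists N, forall n, (N <= n)%N ->
    \sum_(j <- s) `|e n j * D j| < d.
  elim: s d => [|j s ih] d d0; first by exists 0%N => n _; rewrite big_nil.
  have d20 : 0 < d / 2 by rewrite divr_gt0.
  have [N1 sN] := ih _ d20.
  have [|N2 jN] := e0 j (d / 2 / (`|D j| + 1)).
    by rewrite divr_gt0// ltr_wpDl.
  exists (maxn N1 N2) => n; rewrite geq_max => /andP[n1 n2].
  rewrite big_cons [d]splitr ltrD ?sN// normrM.
  have := jN _ n2; rewrite ltr_pdivlMr ?ltr_wpDl//; apply: le_lt_trans.
  by rewrite ler_wpM2l// lerDl.
move=> d d0; have d20 : 0 < d / 2 by rewrite divr_gt0.
have M10 : 0 < `|M| + 1 by rewrite ltr_wpDl.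
have [A AD] := summable_tail sD (divr_gt0 d20 M10).
have [N AN] := fin A _ d20; exists N => n Nn.
have sup : \sum_(j <- A) `|e n j * D j| + d / 2 < d by rewrite [ltRHS]splitr
  ltrD2r AN.
apply: le_lt_trans sup; apply: ler_norm_tsum => B.
rewrite (big_fsetID _ (mem A))/= lerD//.
  apply: ler_sum_fset => //; apply/fsubsetP => j.
  by rewrite !inE/= => /andP[].
set C := [fset _ | _ in _ & _]%fset.
have /AD : fdisjoint A C.
  by apply/fdisjointP => j jA; rewrite !inE/= jA andbF.
rewrite ltr_pdivlMr// => /ltW; apply: le_trans.
rewrite mulrC mulr_sumr; apply: ler_sum => j _.
by rewrite normrM ler_wpM2r.
Qed.

Lemma ler_exprz (r : K) (m n : int) : 0 < r -> r < 1 -> m <= n -> r ^ n <= r ^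
  m.
Proof.
move=> r0 r1 mn; have [k ->] : exists k : nat, n = m + k%:Z.
  by exists `|n - m|%N; lia.
rewrite expfzDr ?gt_eqF//; have rk : r ^+ k <= 1 by rewrite exprn_ile1// ltW.
by rewrite ler_piMr// exprz_ge0// ltW.
Qed.

Lemma norm_exprz (r x : K) : 0 < r -> r < 1 -> x != 0 ->
  exists X : nat, forall n : int, `|x ^ n| <= r ^ (- (X%:Z * `|n|)).
Proof.
move=> r0 r1 x0; have sr : summable (fun n : nat => r ^+ n).
  by apply: summable_geometric; rewrite ltW.
have small y : 0 < y -> exists N, forall n, (N <= n)%N -> r ^+ n <= y.
  move=> y0; have [N rN] := summable_small sr y0; exists N => n Nn.
  by have := ltW (rN _ Nn); rewrite ger0_norm// exprn_ge0// ltW.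
have [|N1 x1] := small `|x|; first by rewrite normr_gt0.
have [|N2 x2] := small `|x|^-1; first by rewrite invr_gt0 normr_gt0.
pose X := maxn N1 N2; exists X => n.
have {}x1 : r ^+ X <= `|x| by rewrite x1 ?leq_maxl.
have {}x2 : `|x| <= (r ^+ X)^-1.
  by rewrite -[leLHS]invrK lef_pV2 ?posrE ?invr_gt0 ?exprn_gt0 ?normr_gt0// x2
    ?leq_maxr.
have -> : r ^ (- (X%:Z * `|n|)) = (r ^+ X)^-1 ^+ `|n|%N.
  by rewrite -mulrN -exprz_exp -abszE -exprz_inv.
have r0X := exprn_gt0 X r0.
case: n => n; rewrite ?NegzE -?exprnP ?normrX.
  by rewrite lerXn2r ?qualifE//= invr_ge0 ltW.
rewrite -exprnN normfV normrX -exprVn abszN lerXn2r ?qualifE/= ?invr_ge0 ?(ltW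
  r0X)//.
by rewrite lef_pV2 ?posrE ?normr_gt0.
Qed.

Lemma summable_expz (r : K) (F : int -> K) (c : int) : 0 < r -> r < 1 ->
  (forall n, `|F n| <= r ^ (`|n| - c)) -> summable F.
Proof.
move=> r0 r1 Fr; have r01 : 0 <= r < 1 by rewrite ltW.
apply: summable_le (summableZ (r ^ (- c)) (summable_geometricz r01)) _.
move=> n; apply: le_trans (Fr n) _; rewrite addrC expfzDr ?gt_eqF// -abszE.
by rewrite ger0_norm// mulr_ge0 ?exprz_ge0 ?exprn_ge0// ltW.
Qed.

Lemma summable_expz2 (r : K) (F : int * int -> K) (c : int) : 0 < r -> r < 1 ->
  (forall m n, `|F (m, n)| <= r ^ (`|m| + `|n| - c)) -> summable F.
Proof.
move=> r0 r1 Fr; have r01 : 0 <= r < 1 by rewrite ltW.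
have sr := summable_geometricz r01.
apply: summable_le (summableZ (r ^ (- c)) (summable_pair sr sr)) _.
move=> [m n]; apply: le_trans (Fr m n) _.
rewrite addrC !expfzDr ?gt_eqF// -!abszE/=.
by rewrite ger0_norm// !mulr_ge0 ?exprz_ge0 ?exprn_ge0// ltW.
Qed.

Lemma sqrt_norm_q (q : K) : q != 0 -> `|q| < 1 ->
  exists r : K, [/\ 0 < r, r < 1 & `|q| = r ^ 2].
Proof.
move=> q0 q1; exists (sqrtC `|q|); split.
- by rewrite sqrtC_gt0 normr_gt0.
- by rewrite -sqrtC1 ltr_sqrtC ?qualifE/=.
- by rewrite -[RHS]/(sqrtC `|q| ^+ 2) sqrtCK.
Qed.

End PowerBounds.

Lemma binz2 (n : int) : 2 * binz n = n * (n - 1).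
Proof.
suff [k nk] : exists k, n * (n - 1) = 2 * k by rewrite /binz nk mulKz.
have [m [->|->]] : exists m : int, n = 2 * m \/ n = 2 * m + 1.
  by exists (n %/ 2)%Z; have := divz_eq n 2; have := modz_ge0 n (d := 2);
    have := ltz_pmod n (d := 2); lia.
- by exists (m * (2 * m - 1)); ring.
- by exists ((2 * m + 1) * m); ring.
Qed.

Lemma signzD (F : numFieldType) (m n : int) :
  (-1) ^ (m + n) = (-1) ^ m * (-1) ^ n :> F.
Proof. by rewrite expfzDr// oppr_eq0 oner_eq0. Qed.

Lemma signz_even (F : numFieldType) (m n c : int) :
  m = n + 2 * c -> (-1) ^ m = (-1) ^ n :> F.
Proof.
by move=> ->; rewrite signzD -(exprz_exp _ 2 c) -exprnP sqrrN expr1n exp1rz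
  mulr1.
Qed.

Lemma norm_expz (F : numFieldType) (x : F) (n : int) : `|x ^ n| = `|x| ^ n.
Proof.
by case: n => n; rewrite ?NegzE -?exprnN -?exprnP ?normfV ?normrX.
Qed.

Lemma norm_signz (F : numFieldType) (n : int) : `|(-1) ^ n| = 1 :> F.
Proof. by rewrite norm_expz normrN1 exp1rz. Qed.

Section SequenceLimits.
Variable F : numFieldType.
Implicit Types (u v : nat -> F) (l m : F).

Definition tends u l := forall e : F, 0 < e ->
  exists N, forall n, (N <= n)%N -> `|l - u n| < e.

Lemma tendsP u l : tends u l <-> (u n @[n --> \oo] --> l)%classic.
Proof.
split=> [ul|/cvgrPdist_lt ul].
  by apply/cvgrPdist_lt => e /ul[N uN]; exists N.
by move=> e /ul[N _ uN]; exists N => n Nn; exact: uN.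
Qed.

Lemma tendsM u v l m : tends u l -> tends v m ->
  tends (fun n => u n * v n) (l * m).
Proof. by rewrite !tendsP; exact: cvgM. Qed.

Lemma tendsV u l : l != 0 -> tends u l -> tends (fun n => (u n)^-1) l^-1.
Proof. by rewrite !tendsP; exact: cvgV. Qed.

Lemma tends_unique u l m : tends u l -> tends u m -> l = m.
Proof.
rewrite !tendsP => ul um.
by rewrite -(cvg_lim (@norm_hausdorff _ _) ul) (cvg_lim (@norm_hausdorff _ _)
  um).
Qed.

End SequenceLimits.

(** * The Jacobi triple product *)

Section TripleProduct.
Variable R : realType.
Local Notation K := R[i].
Variable q : K.
Hypotheses (q0 : q != 0) (q1 : `|q| < 1).

Definition theta_term (x : K) (n : int) : K := (-1) ^ n * q ^ binz n * x ^ n.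

Lemma summable_theta (x : K) : x != 0 -> summable (theta_term x).
Proof.
move=> x0; have [r [r0 r1 qr]] := sqrt_norm_q q0 q1.
have [X xX] := norm_exprz r0 r1 x0.
apply: (@summable_expz _ r _ ((X%:Z + 2) * (X%:Z + 2)) r0 r1) => n.
rewrite !normrM norm_signz mul1r norm_expz qr exprz_exp.
apply: le_trans (ler_wpM2l _ (xX n)) _; first by rewrite exprz_ge0 // ltW.
rewrite -expfzDr ?gt_eqF// ler_exprz// binz2.
have : `|n| = n \/ `|n| = - n by lia.
have : 0 <= (`|n| - (X%:Z + 2)) * (`|n| - (X%:Z + 2)) by rewrite -expr2 sqr_ge0.
by move: `|n| => y; nia.
Qed.

(* The involution i -> 1 - 2c - i reverses the sign of the terms. *)
Lemma theta_sum_intpow (c : int) : tsum (theta_term (q ^ c)) = 0.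
Proof.
have qc0 : q ^ c != 0 by exact: expfz_neq0.
have sT := summable_theta qc0.
pose f (i : int) := 1 - 2 * c - i.
have fB : bijective f by exists f => i; rewrite /f; lia.
have := tsum_bij fB sT.
have E i : theta_term (q ^ c) i = (-1) ^ i * q ^ (binz i + c * i).
  by rewrite /theta_term exprz_exp -mulrA -(expfzDr _ _ q0).
have -> : theta_term (q ^ c) \o f = fun i => (-1) * theta_term (q ^ c) i.
  apply/funext => i; rewrite /= !E mulrA.
  rewrite (_ : -1 * (-1) ^ i = (-1) ^ (1 + i)); last by rewrite signzD expr1z.
  congr (_ * _); first by apply: (@signz_even _ _ _ (- c - i)); rewrite /f; lia.
  congr (q ^ _); have := binz2 i; have := binz2 (f i); rewrite /f; nia.
rewrite tsumZ// mulN1r => /eqP; rewrite eq_sym -subr_eq0 opprK -mulr2n.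
by rewrite mulrn_eq0 => /eqP.
Qed.

Lemma theta_sum_inv (x : K) : x != 0 ->
  tsum (theta_term x^-1) = - x^-1 * tsum (theta_term x).
Proof.
move=> x0; have sT := summable_theta x0.
pose f (i : int) := 1 - i.
have fB : bijective f by exists f => i; rewrite /f; lia.
rewrite -(tsum_bij fB sT) -tsumZ; last exact: (summable_inj (bij_inj fB)).
congr tsum; apply/funext => i; rewrite /= /theta_term /f.
rewrite (_ : binz (1 - i) = binz i); last by have := binz2 i;
  have := binz2 (1 - i); nia.
rewrite exprz_inv (expfzDr 1 _ x0) expr1z signzD expr1z.
by rewrite (@signz_even _ (- i) i (- i)); [field | lia].
Qed.

(* Extending 1/(q)_z by 0 to z < 0 makes the recurrence for 1/(q)_z hold for all
   integers z, so that the finite triple product is a sum over all of int. *)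
Definition invqpoch (z : int) : K := if 0 <= z then (qpoch q q `|z|%N)^-1 else
  0.

Lemma qn_neq1 n : q * q ^+ n != 1.
Proof.
rewrite -exprS; apply: contraTneq q1 => qn;
  have : `|q| ^+ n.+1 = 1 by rewrite -normrX qn normr1.
by move=> /eqP; rewrite pexpr_eq1// => /eqP ->; rewrite ltxx.
Qed.

Lemma qpoch_neq0 n : qpoch q q n != 0.
Proof.
rewrite qpochE; apply/prodf_neq0 => i _; by rewrite subr_eq0 eq_sym qn_neq1.
Qed.

Lemma qpochS (a : K) n : qpoch a q n.+1 = qpoch a q n * (1 - a * q ^+ n).
Proof. by rewrite !qpochE big_ord_recr. Qed.

Lemma invqpoch_rec z : invqpoch (z - 1) = (1 - q ^ z) * invqpoch z.
Proof.
rewrite /invqpoch; case: z => [[|n]|n].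
- by rewrite /= expr0z subrr mul0r.
- rewrite (_ : Posz n.+1 - 1 = n); last by lia.
  rewrite !le0z_nat !absz_nat qpochS -exprnP exprS.
  have := qpoch_neq0 n; have := qn_neq1 n => qn1 pn; field.
  by rewrite pn subr_eq0 eq_sym qn1.
- have -> : (0 <= Negz n - 1) = false by lia.
  by rewrite mulr0.
Qed.

Definition jtp_coef n (j : int) : K :=
  qpoch q q (2 * n) * invqpoch (n%:Z - j) * invqpoch (n%:Z + j).

Lemma jtp_coef_bounded : exists M, forall n j, `|jtp_coef n j| <= M.
Proof.
have [_ [M Mq]] := qpochoo_neq0 q1 qn_neq1; have [M' M'q] := qpoch_bounded q q1.
have M0 : 0 <= M := le_trans (normr_ge0 _) (Mq 0%N).
have Qq z : `|invqpoch z| <= M.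
  by rewrite /invqpoch; case: ifP; rewrite ?normr0.
by exists (M' * M * M) => n j; rewrite !normrM !ler_pM// mulr_ge0.
Qed.

Lemma jtp_coef_rec n j : jtp_coef n.+1 j =
  (1 + q ^+ (2 * n).+1) * jtp_coef n j
  + q ^ (n%:Z - j + 1) * jtp_coef n (j - 1)
  + q ^ (n%:Z + j + 1) * jtp_coef n (j + 1).
Proof.
rewrite /jtp_coef mulnS !qpochS.
pose a := n%:Z - j + 1; pose b := n%:Z + j + 1.
have -> : Posz n.+1 - j = a by rewrite /a; lia.
have -> : Posz n.+1 + j = b by rewrite /b; lia.
have -> : n%:Z - (j - 1) = a by rewrite /a; lia.
have -> : n%:Z + (j + 1) = b by rewrite /b; lia.
have -> : n%:Z - (j + 1) = a - 1 - 1 by rewrite /a; lia.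
have -> : n%:Z + (j - 1) = b - 1 - 1 by rewrite /b; lia.
have -> : n%:Z - j = a - 1 by rewrite /a; lia.
have -> : n%:Z + j = b - 1 by rewrite /b; lia.
have qB z : q ^ (z - 1) = q ^ z / q by rewrite expfzDr.
rewrite !invqpoch_rec !qB !subrK.
have E : q ^+ (2 * n) * q ^+ 2 = q ^ a * q ^ b.
  by rewrite -expfzDr// -exprD exprnP; congr (q ^ _); rewrite /a /b; lia.
have {}E : q ^+ (2 * n) = q ^ a * q ^ b / q ^+ 2 by rewrite -E mulfK//
  expf_neq0.
by rewrite !exprS E; field.
Qed.

Lemma theta_termS (x : K) k : x != 0 ->
  theta_term x (k + 1) = - (x * q ^ k) * theta_term x k.
Proof.
move=> x0; rewrite /theta_term (_ : binz (k + 1) = k + binz k); last first.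
  by have := binz2 k; have := binz2 (k + 1); nia.
by rewrite signzD (expfzDr _ _ q0) (expfzDr _ _ x0) !expr1z; ring.
Qed.

Lemma summable_jtp (x : K) n : x != 0 ->
  summable (fun j => jtp_coef n j * theta_term x j).
Proof.
move=> /summable_theta sT; have [M cM] := jtp_coef_bounded.
have M0 : 0 <= M := le_trans (normr_ge0 _) (cM 0%N 0).
apply: summable_le (summableZ M sT) _ => j.
by rewrite normrM [leRHS]normrM (ger0_norm M0) ler_wpM2r.
Qed.

Lemma jtp_finite (x : K) n : x != 0 -> qpoch x q n * qpoch (q / x) q n =
  tsum (fun j => jtp_coef n j * theta_term x j).
Proof.
move=> x0; elim: n => [|n ih].
  rewrite (@tsum_single _ _ _ 0).
  - by rewrite /jtp_coef /invqpoch /theta_term /qpoch !big_geq//= !expr0z invr1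
    !mulr1.
  - move=> j j0; rewrite /jtp_coef /invqpoch sub0r add0r.
    have [|] : (0 <= - j) = false \/ (0 <= j) = false by lia.
      by move=> ->; rewrite mulr0 !mul0r.
    by move=> ->; rewrite mulr0 mul0r.
  - exact: summable_jtp.
set S := tsum _ in ih.
have sG := summable_jtp n x0; set G := fun j => _ in ih sG *.
pose up (j : int) := j + 1; pose dn (j : int) := j - 1.
have upB : bijective up by exists dn => j; rewrite /up /dn; lia.
have dnB : bijective dn by exists up => j; rewrite /up /dn; lia.
have -> : (fun j => jtp_coef n.+1 j * theta_term x j) = fun j =>
    ((1 + q ^+ (2 * n).+1) * G j + - (x * q ^+ n) * (G \o dn) j)
    + - (q / x * q ^+ n) * (G \o up) j.
  apply/funext => j; rewrite jtp_coef_rec /G /=.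
  rewrite /dn /up.
  have h1 : q ^ (n%:Z - j + 1) * theta_term x j = - (x * q ^+ n) * theta_term x
    (j - 1).
    rewrite -{2}(subrK 1 j) theta_termS// mulrA; congr (_ * _).
    rewrite mulrN mulrCA -(expfzDr _ _ q0) exprnP; congr (- (_ * q ^ _)); lia.
  have h2 : q ^ (n%:Z + j + 1) * theta_term x j = - (q / x * q ^+ n) *
    theta_term x (j + 1).
    rewrite theta_termS// mulrA; congr (_ * _).
    have -> : q ^ (n%:Z + j + 1) = q ^+ n * q ^ j * q by rewrite !(expfzDr _ _
      q0) expr1z exprnP.
    by field.
  transitivity ((1 + q ^+ (2 * n).+1) * (jtp_coef n j * theta_term x j)
    + jtp_coef n (j - 1) * (q ^ (n%:Z - j + 1) * theta_term x j)
    + jtp_coef n (j + 1) * (q ^ (n%:Z + j + 1) * theta_term x j)).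
    by move: (q ^ _) (q ^ _) => A B; ring.
  by rewrite h1 h2; ring.
have sdn := summable_inj (bij_inj dnB) sG;
  have sup := summable_inj (bij_inj upB) sG.
have s1 := summableZ (1 + q ^+ (2 * n).+1) sG.
have s2 := summableZ (- (x * q ^+ n)) sdn;
  have s3 := summableZ (- (q / x * q ^+ n)) sup.
rewrite (tsumD (summableD s1 s2) s3) (tsumD s1 s2).
rewrite !tsumZ// (tsum_bij dnB sG) (tsum_bij upB sG) -/S -ih.
by rewrite !qpochS exprS mulnC exprM; field.
Qed.

Lemma tends_qpoch (a : K) : tends (qpoch a q) (qpochoo a q).
Proof. by apply/tendsP/cvg_qpoch. Qed.

Lemma tends_invqpoch j :
  tends (fun n => invqpoch (n%:Z + j)) (qpochoo q q)^-1.
Proof.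
have [L0 _] := qpochoo_neq0 q1 qn_neq1.
move=> e e0; have [N NL] := tendsV L0 (tends_qpoch q) e0.
exists (N + `|j|)%N => n Nn; rewrite /invqpoch ifT; last by lia.
by apply: NL; lia.
Qed.

Lemma tends_jtp_coef j : tends (fun n => jtp_coef n j) (qpochoo q q)^-1.
Proof.
have [L0 _] := qpochoo_neq0 q1 qn_neq1.
have -> : (qpochoo q q)^-1 = qpochoo q q * (qpochoo q q)^-1 * (qpochoo q q)^-1.
  by rewrite mulfV// mul1r.
apply: tendsM; last exact: tends_invqpoch.
apply: tendsM; last exact: tends_invqpoch.
move=> e e0; have [N NL] := tends_qpoch q e0.
by exists N => n Nn; apply: NL; lia.
Qed.

Lemma jacobi_triple_product (x : K) : x != 0 -> theta x q = tsum (theta_term x).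
Proof.
move=> x0; have [L0 _] := qpochoo_neq0 q1 qn_neq1; set L := qpochoo q q in L0.
have sT := summable_theta x0; set S := tsum _.
have [M cM] := jtp_coef_bounded.
pose e n j := jtp_coef n j - L^-1.
have eM n j : `|e n j| <= M + `|L^-1|.
  by apply: le_trans (ler_normB _ _) _; rewrite lerD2r.
have e0 j d : 0 < d -> exists N, forall n, (N <= n)%N -> `|e n j| < d.
  by move=> /(tends_jtp_coef j)[N NL]; exists N => n /NL; rewrite /e distrC.
have lim := tannery sT eM e0.
have eE n : tsum (fun j => e n j * theta_term x j) =
    qpoch x q n * qpoch (q / x) q n - L^-1 * S.
  rewrite jtp_finite// -mulNr -tsumZ// -tsumD; first last.
  - exact: summableZ.
  - exact: summable_jtp.
  by congr tsum; apply/funext => j; rewrite /e; ring.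
have cS : tends (fun n => qpoch x q n * qpoch (q / x) q n) (L^-1 * S).
  by move=> d /lim[N NL]; exists N => n /NL; rewrite eE distrC.
have E := tends_unique (tendsM (tends_qpoch x) (tends_qpoch (q / x))) cS.
by rewrite /theta E -/L mulrAC mulVf// mul1r.
Qed.

Lemma theta_neq0 (x : K) : x != 0 -> (forall n : int, x != q ^ n) -> theta x q
  != 0.
Proof.
move=> x0 xq; rewrite /theta !mulf_neq0//.
- apply: (qpochoo_neq0 q1 _).1 => n; apply: contra (xq (- n%:Z)) => /eqP E.
  by rewrite -invr_expz -exprnP -[x](mulfK (expf_neq0 n q0)) E mul1r.
- apply: (qpochoo_neq0 q1 _).1 => n; apply: contra (xq n.+1) => /eqP E.
  by rewrite -exprnP exprS -[x]mul1r -E; apply/eqP; field.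
- by have [] := qpochoo_neq0 q1 qn_neq1.
Qed.

End TripleProduct.

(** * Growth of the quadratic exponents *)

Lemma sg2E (F : numFieldType) (r s : int) :
  sg2 F r s = (0 <= r)%R%:R + (0 <= s)%R%:R - 1.
Proof.
by rewrite /sg2 /sg; case: (0 <= r); case: (0 <= s);
  rewrite ?rmorphD ?rmorphN ?rmorph1/=; field.
Qed.

Variant sg2_spec (F : numFieldType) (r s : int) : F -> Prop :=
| Sg2Pos of 0 <= r & 0 <= s : sg2_spec r s 1
| Sg2Neg of r <= -1 & s <= -1 : sg2_spec r s (-1)
| Sg2Zero : sg2_spec r s 0.

Lemma sg2P (F : numFieldType) (r s : int) : sg2_spec r s (sg2 F r s).
Proof.
rewrite sg2E; have [r0|r0] := leP 0 r; have [s0|s0] := leP 0 s.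
- by rewrite addrK; constructor.
- by rewrite addr0 subrr; constructor.
- by rewrite add0r subrr; constructor.
- by rewrite add0r sub0r; constructor; lia.
Qed.

Lemma quad_bound (t b r s : int) : 1 <= t ->
  (0 <= r /\ 0 <= s) \/ (r <= -1 /\ s <= -1) ->
  `|r| + `|s| - ((`|b| + 1) * (`|b| + 1) + 1) <=
  2 * (binz (r + 1) + 2 * t * r * s + binz (s + 1) + b * r).
Proof.
move=> t1 rs.
have -> : 2 * (binz (r + 1) + 2 * t * r * s + binz (s + 1) + b * r) =
    r * r + r + 4 * (t * (r * s)) + (s * s + s) + 2 * (b * r).
  by have := binz2 (r + 1); have := binz2 (s + 1); lia.
have rs0 : 0 <= r * s by nia.
have trs0 : 0 <= t * (r * s) by nia.
have br : - (`|b| * `|r|) <= b * r by rewrite -normrM; lia.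
have rr : r * r = `|r| * `|r| by rewrite -normrM ger0_norm// -expr2 sqr_ge0.
have ss : s * s = `|s| * `|s| by rewrite -normrM ger0_norm// -expr2 sqr_ge0.
have h1 : 0 <= (`|r| - (`|b| + 1)) * (`|r| - (`|b| + 1)) by rewrite -expr2
  sqr_ge0.
have h2 : 0 <= (`|s| - 1) * (`|s| - 1) by rewrite -expr2 sqr_ge0.
have r1 : - `|r| <= r by lia. have s1 : - `|s| <= s by lia.
rewrite rr ss; move: (`|r|) (`|s|) (`|b|) r1 s1 br h1 h2 => y z w.
move: (b * r) (t * (r * s)) trs0 => br trs; nia.
Qed.

Section Bounds.
Variables t a X : int.
Hypotheses (t1 : 1 <= t) (a0 : 0 <= a) (a2 : a <= 2 * t - 1) (X0 : 0 <= X).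

Let C := 4 * ((X + 2) * (X + 2)).

(* Where i r < 0 the four squares only control d = |n| + |i| - |r|; what remains
   is bounded using 2trs - ar >= |r| if r, s < 0, and |n r| if r, s >= 0. *)
Lemma quad_bound4 (n i r s : int) :
  (0 <= - n /\ 0 <= i) \/ (- n <= -1 /\ i <= -1) ->
  (0 <= r /\ 0 <= s) \/ (r <= -1 /\ s <= -1) ->
  `|n| + `|i| + (`|r| + `|s| - C) <= 2 * (binz (n - i) + i * r
    + (binz (r + 1) + 2 * t * r * s + binz (s + 1) + a * r)) - X * `|n|.
Proof.
have -> : 2 * (binz (n - i) + i * r + (binz (r + 1) + 2 * t * r * s
   + binz (s + 1) + a * r)) = (n - i) * (n - i) - (n - i) + 2 * (i * r)
   + r * r + r + 4 * (t * (r * s)) + s * s + s + 2 * (a * r).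
  by have := binz2 (n - i); have := binz2 (r + 1); have := binz2 (s + 1); lia.
rewrite /C; case=> -[n0 i0] [] [r0 s0].
- pose p := - n; have -> : n = - p by rewrite /p opprK.
  have p0 : 0 <= p by []; move: p p0 => p p0 {n0}.
  rewrite normrN !ger0_norm//.
  have h1 : 0 <= t * (r * s) by rewrite !mulr_ge0//; lia.
  have h2 : 0 <= a * r by rewrite mulr_ge0.
  have h3 : 0 <= i * r by rewrite mulr_ge0.
  have h4 : 0 <= p * i by rewrite mulr_ge0.
  have h5 : 0 <= (p - X) * (p - X) by rewrite -expr2 sqr_ge0.
  have h6 : 0 <= X * p by rewrite mulr_ge0.
  move: (t * (r * s)) (a * r) h1 h2 => A B h1 h2; nia.
- pose p := - n; have -> : n = - p by rewrite /p opprK.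
  have p0 : 0 <= p by []; move: p p0 => p p0 {n0}.
  pose S := - s; have -> : s = - S by rewrite /S opprK.
  have S0 : 1 <= S by rewrite /S; lia.
  move: S S0 => S S0 {s0 s}.
  pose Q := - r; have -> : r = - Q by rewrite /Q opprK.
  have Q0 : 1 <= Q by rewrite /Q; lia.
  move: Q Q0 => Q Q0 {r0 r}.
  rewrite !normrN !ger0_norm//; try lia.
  have h1 : 2 * (a * Q) + 2 * Q <= 4 * (t * (Q * S)).
    have : 0 <= t * (Q * (S - 1)) by rewrite !mulr_ge0//; lia.
    have : 0 <= (2 * t - 1 - a) * Q by rewrite mulr_ge0//; lia.
    by nia.
  have h2 : 0 <= (S - 1) * (S - 1) by rewrite -expr2 sqr_ge0.
  pose d := p + i - Q.
  have h3 : d * d + 2 * (p * Q) >= X * p - 3 * ((X + 2) * (X + 2)).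
    rewrite /d; have [QX|QX] := leP X Q.
      have : 0 <= d * d by rewrite -expr2 sqr_ge0.
      have : 0 <= p * (Q - X) by rewrite mulr_ge0//; lia.
      have : 0 <= p * Q by rewrite mulr_ge0//; lia.
      by rewrite /d; nia.
    have [pX|pX] := leP p X.
      have : 0 <= d * d by rewrite -expr2 sqr_ge0.
      have : 0 <= p * Q by rewrite mulr_ge0//; lia.
      have : 0 <= X * (X - p) by rewrite mulr_ge0//; lia.
      by rewrite /d; nia.
    have : (p - X) * (p - X) <= d * d by rewrite ler_pM// /d; lia.
    have : 0 <= p * Q by rewrite mulr_ge0//; lia.
    have : 0 <= (p - 2 * X) * (p - 2 * X) by rewrite -expr2 sqr_ge0.
    by rewrite /d; nia.
  have h4 : 1 <= (X + 2) * (X + 2) by nia.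
  by rewrite /d in h3; lia.
- pose j := - i; have -> : i = - j by rewrite /j opprK.
  have j1 : 1 <= j by rewrite /j; lia.
  have n1 : 1 <= n by lia.
  move: j j1 => j j1 {i0 i n0}.
  rewrite !normrN !ger0_norm//; try lia.
  have h1 : 0 <= t * (r * s) by rewrite !mulr_ge0//; lia.
  have h2 : 0 <= a * r by rewrite mulr_ge0.
  have h3 : 0 <= s * s by rewrite -expr2 sqr_ge0.
  pose d := n + j - r.
  have h4 : d * d - 2 * d + 2 * ((n - 1) * r) >= X * n - 4 * ((X + 2) * (X +
    2)).
    have h5 : 0 <= (d - 1) * (d - 1) by rewrite -expr2 sqr_ge0.
    have [rX|rX] := leP X r.
      have : 0 <= (n - 1) * (r - X) by rewrite mulr_ge0//; lia.
      have : 0 <= X * (n - 1) by rewrite mulr_ge0//; lia.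
      by nia.
    have h6 : 0 <= (n - 1) * r by rewrite mulr_ge0//; lia.
    have [nX|nX] := leP n (2 * X).
      have : 0 <= X * (2 * X - n) by rewrite mulr_ge0//; lia.
      by nia.
    have : (n - X) * (n - X) <= (d - 1) * (d - 1) by rewrite ler_pM // /d; lia.
    have : 0 <= (n - 2 * X) * (n - 2 * X) by rewrite -expr2 sqr_ge0.
    by nia.
  by rewrite /d in h4; lia.
- pose j := - i; have -> : i = - j by rewrite /j opprK.
  have j1 : 1 <= j by rewrite /j; lia.
  have n1 : 1 <= n by lia.
  move: j j1 => j j1 {i0 i n0}.
  pose S := - s; have -> : s = - S by rewrite /S opprK.
  have S0 : 1 <= S by rewrite /S; lia.
  move: S S0 => S S0 {s0 s}.
  pose Q := - r; have -> : r = - Q by rewrite /Q opprK.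
  have Q0 : 1 <= Q by rewrite /Q; lia.
  move: Q Q0 => Q Q0 {r0 r}.
  rewrite !normrN !ger0_norm//; try lia.
  have h1 : 2 * (a * Q) + 2 * Q <= 4 * (t * (Q * S)).
    have : 0 <= t * (Q * (S - 1)) by rewrite !mulr_ge0//; lia.
    have : 0 <= (2 * t - 1 - a) * Q by rewrite mulr_ge0//; lia.
    by nia.
  have h2 : 0 <= (S - 1) * (S - 1) by rewrite -expr2 sqr_ge0.
  have h3 : 0 <= (Q - 1) * (Q - 1) by rewrite -expr2 sqr_ge0.
  have h4 : 0 <= j * Q by rewrite mulr_ge0//; lia.
  have h5 : 0 <= (n + j - (X + 2)) * (n + j - (X + 2)) by rewrite -expr2
    sqr_ge0.
  have h6 : 0 <= X * j by rewrite mulr_ge0//; lia.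
  have h7 : 0 <= X * n by rewrite mulr_ge0//; lia.
  have h8 : 0 <= X * X by rewrite mulr_ge0.
  by lia.
Qed.
End Bounds.

Section SumsOfSums.
Variable R : realType.
Local Notation K := R[i].
Implicit Types I J : choiceType.

Lemma tsumZl I (F : I -> K) c : summable (fun i => c * F i) ->
  tsum (fun i => c * F i) = c * tsum F.
Proof.
have [-> sF|c0 sF] := eqVneq c 0.
  rewrite mul0r; apply: tsumE; under eq_fun do rewrite mul0r.
  by move=> e e0; exists fset0 => B _; rewrite big1// subrr normr0.
rewrite tsumZ//; apply: summable_le (summableZ c^-1 sF) _ => i.
by rewrite mulKf.
Qed.

Lemma summable_tsum I J (F : I * J -> K) (u : I -> K) (v : J -> K) :
  summable u -> summable v -> (forall i j, `|F (i, j)| <= `|u i| * `|v j|) ->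
  summable (fun i => tsum (fun j => F (i, j))).
Proof.
move=> su [M vM] Fuv; apply: summable_le (summableZ M su) _ => i.
have M0 : 0 <= M by have := vM fset0; rewrite big_seq_fset0.
rewrite normrM (ger0_norm M0); apply: ler_norm_tsum => B.
rewrite mulrC; apply: le_trans (ler_wpM2l (normr_ge0 _) (vM B)).
by rewrite mulr_sumr; apply: ler_sum => j _.
Qed.

End SumsOfSums.

(** * The double sum F and the fourfold sum *)

Section HeckeSum.
Variable R : realType.
Local Notation K := R[i].
Variable q : K.
Hypotheses (q0 : q != 0) (q1 : `|q| < 1).
Variable t : int.
Hypothesis t1 : 1 <= t.

(* Summand of f_{1,2t,1}(q^(b+1), q^(b'+1)), without the factor sg(r,s). *)
Definition quad_term (b b' : int) (p : int * int) : K :=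
  (-1) ^ (p.1 + p.2)
  * q ^ (binz (p.1 + 1) + 2 * t * p.1 * p.2 + binz (p.2 + 1) + b * p.1 + b' *
    p.2).

Lemma ler_norm_quad (r : K) b p : 0 < r -> r < 1 -> `|q| = r ^ 2 ->
  (0 <= p.1 /\ 0 <= p.2) \/ (p.1 <= -1 /\ p.2 <= -1) ->
  `|quad_term b 0 p| <= r ^ (`|p.1| + `|p.2| - ((`|b| + 1) * (`|b| + 1) + 1)).
Proof.
move=> r0 r1 qr rs.
rewrite normrM norm_signz mul1r norm_expz qr exprz_exp ler_exprz// mul0r addr0.
exact: quad_bound.
Qed.

Definition hecke_term (b : int) (p : int * int) : K :=
  sg2 K p.1 p.2 * quad_term b 0 p.

Lemma summable_hecke_term b : summable (hecke_term b).
Proof.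
have [r [r0 r1 qr]] := sqrt_norm_q q0 q1.
apply: (@summable_expz2 _ r _ ((`|b| + 1) * (`|b| + 1) + 1) r0 r1) => m n.
rewrite /hecke_term /=; case: sg2P => [m0 n0|m0 n0|]; last first.
- by rewrite mul0r normr0 exprz_ge0 // ltW.
- by rewrite normrM normrN1 mul1r (@ler_norm_quad r)//; right.
- by rewrite mul1r (@ler_norm_quad r)//; left.
Qed.

Lemma hassum_theta_shift (c c0 c1 : int) :
  hassum (fun s : int => (-1) ^ (c0 + s) * q ^ (binz (s + 1) + c * s + c1)) 0.
Proof.
have qc0 : q ^ (c + 1) != 0 by exact: expfz_neq0.
have := hassumP (summable_theta q0 q1 qc0).
rewrite theta_sum_intpow// => /(hassumZ ((-1) ^ c0 * q ^ c1)); rewrite mulr0.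
congr hassum; apply/funext => s.
rewrite /theta_term exprz_exp signzD.
have -> : q ^ (binz (s + 1) + c * s + c1) = q ^ binz s * q ^ ((c + 1) * s) * q
  ^ c1.
  rewrite -!(expfzDr _ _ q0); congr (q ^ _).
  by have := binz2 s; have := binz2 (s + 1); lia.
by move: (q ^ _) (q ^ _) (q ^ _) => A B C; ring.
Qed.

Lemma summable_quad_strip (d : int -> K) (c : int) b b' :
  (forall r, `|d r| <= 1) -> (forall r, c < `|r| -> d r = 0) ->
  summable (fun p => d p.1 * quad_term b b' p).
Proof.
move=> d1 dc; have [r [r0 r1 qr]] := sqrt_norm_q q0 q1.
apply: (@summable_expz2 _ r _ ((t * `|c| + `|b| + `|b'| + 2) * (t * `|c| + `|b|
  + `|b'| + 2) * 5) r0 r1) => m n.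
have [mc|mc] := ltP c `|m|;
  first by rewrite /= dc// mul0r normr0 exprz_ge0 // ltW.
rewrite /= normrM; apply: le_trans (ler_piMl (normr_ge0 _) (d1 m)) _.
rewrite normrM norm_signz mul1r norm_expz qr exprz_exp ler_exprz//=.
have -> : 2 * (binz (m + 1) + 2 * t * m * n + binz (n + 1) + b * m + b' * n) =
  m * m + m + 4 * (t * m * n) + n * n + n + 2 * (b * m) + 2 * (b' * n).
  by have := binz2 (m + 1); have := binz2 (n + 1); lia.
have mm : m * m = `|m| * `|m| by rewrite -normrM ger0_norm// -expr2 sqr_ge0.
have nn : n * n = `|n| * `|n| by rewrite -normrM ger0_norm// -expr2 sqr_ge0.
have tmn : - (t * `|c| * `|n|) <= t * m * n.
  have : `|t * m * n| <= t * `|c| * `|n|.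
    rewrite !normrM (ger0_norm (_ : 0 <= t)); last by lia.
    by rewrite ler_wpM2r// ler_wpM2l//; lia.
  by lia.
have bm : - (`|b| * `|m|) <= b * m by rewrite -normrM; lia.
have bn : - (`|b'| * `|n|) <= b' * n by rewrite -normrM; lia.
have tc : 0 <= t * `|c| by rewrite mulr_ge0//; lia.
have m1 : - `|m| <= m by lia. have n1 : - `|n| <= n by lia.
rewrite mm nn.
move: (t * m * n) (b * m) (b' * n) (t * `|c|) tc tmn bm bn => X Y Z w w0 tmn bm
  bn.
have z1 : 0 <= `|b| by []. have z2 : 0 <= `|b'| by [].
have y1 : 0 <= `|m| by []. have y2 : 0 <= `|n| by [].
move: (`|b|) (`|b'|) (`|m|) (`|n|) z1 z2 y1 y2 m1 n1 bm bn tmn => B B' M N z1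
  z2 y1 y2 m1 n1 bm bn tmn.
have h1 : 0 <= (M - (w + B + B' + 2)) * (M - (w + B + B' + 2)) by rewrite
  -expr2 sqr_ge0.
have h2 : 0 <= (N - 2 * (w + B + B' + 2)) * (N - 2 * (w + B + B' + 2)) by
  rewrite -expr2 sqr_ge0.
have h3 : 0 <= (w + B' + 1) * M by rewrite mulr_ge0//; lia.
have h4 : 0 <= (4 * B + 2 * B' + 6) * N by rewrite mulr_ge0//; lia.
by lia.
Qed.

(* Along each line r = const the sum is a theta series at a power of q. *)
Lemma hassum_quad_strip (d : int -> K) (c : int) b b' :
  (forall r, `|d r| <= 1) -> (forall r, c < `|r| -> d r = 0) ->
  hassum (fun p => d p.1 * quad_term b b' p) 0.
Proof.
move=> d1 dc; have sT := summable_quad_strip b b' d1 dc.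
suff : tsum (fun p => d p.1 * quad_term b b' p) = 0 by move=> <-;
  exact: hassumP.
rewrite -tsum_pair//; apply: tsumE.
have -> : (fun i => tsum (fun j => d i * quad_term b b' (i, j))) = fun=> 0.
  apply/funext => i; rewrite tsumZl; last exact: (summable_row i sT).
  rewrite (tsumE (l := 0)) ?mulr0//.
  have := hassum_theta_shift (2 * t * i + b') i (binz (i + 1) + b * i).
  by congr hassum; apply/funext => s; congr (_ * q ^ _); rewrite /=; ring.
by move=> e e0; exists fset0 => B _; rewrite big1// subrr normr0.
Qed.

Lemma hassum_quad_strip2 (d : int -> K) (c : int) b b' :
  (forall r, `|d r| <= 1) -> (forall r, c < `|r| -> d r = 0) ->
  hassum (fun p => d p.2 * quad_term b b' p) 0.
Proof.
move=> d1 dc; pose sw (p : int * int) := (p.2, p.1).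
have swB : bijective sw by exists sw => -[].
have sw0 (F : int * int -> K) i : (forall j, sw j != i) -> F i = 0.
  by case: i => m n /(_ (n, m)); rewrite eqxx.
apply/(hassum_inj _ (bij_inj swB) (sw0 _)).
have := hassum_quad_strip b' b d1 dc; congr hassum; apply/funext => -[m n].
rewrite /quad_term /sw /= [n + m]addrC; congr (_ * (_ * q ^ _)).
by lia.
Qed.

Definition heckeF (b : int) : K := tsum (hecke_term b).

Definition shift_factor (l b : int) : K :=
  (-1) ^ l * q ^ (binz (l + 1) - 2 * t ^+ 2 * l ^+ 2 - t * l + b * l).

Lemma quad_term_shift l b r s :
  quad_term b 0 (r + l, s - 2 * t * l) =
  shift_factor l b * quad_term (b - (4 * t ^+ 2 - 1) * l) 0 (r, s).
Proof.
rewrite /quad_term /shift_factor /=.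
rewrite (@signz_even _ _ (l + (r + s)) (- (t * l))); last by lia.
rewrite signzD.
have -> : binz (r + l + 1) + 2 * t * (r + l) * (s - 2 * t * l)
    + binz (s - 2 * t * l + 1) + b * (r + l) + 0 * (s - 2 * t * l) =
  (binz (l + 1) - 2 * t ^+ 2 * l ^+ 2 - t * l + b * l) +
  (binz (r + 1) + 2 * t * r * s + binz (s + 1) + (b - (4 * t ^+ 2 - 1) * l) * r
    + 0 * s).
  have := binz2 (r + l + 1); have := binz2 (s - 2 * t * l + 1).
  by have := binz2 (l + 1); have := binz2 (r + 1); have := binz2 (s + 1); lia.
by rewrite (expfzDr _ _ q0); move: (q ^ _) (q ^ _) => A B; ring.
Qed.

Lemma heckeF_shift l b :
  heckeF b = shift_factor l b * heckeF (b - (4 * t ^+ 2 - 1) * l).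
Proof.
set b1 := b - _; pose d (l : int) (r : int) : K := (0 <= r + l)%R%:R - (0 <=
  r)%R%:R.
have d1 l' r : `|d l' r| <= 1.
  by rewrite /d; case: (0 <= r + l'); case: (0 <= r);
    rewrite ?subrr ?subr0 ?sub0r ?normr0 ?normrN ?normr1.
have dc l' r : `|l'| < `|r| -> d l' r = 0.
  move=> lr; rewrite /d; have -> : (0 <= r + l') = (0 <= r) by lia.
  by rewrite subrr.
pose sh (p : int * int) := (p.1 + l, p.2 - 2 * t * l).
have shB : bijective sh.
  by exists (fun p => (p.1 - l, p.2 + 2 * t * l)) => -[r s]; rewrite /sh /=;
    congr pair; lia.
have sF := summable_hecke_term b.
rewrite /heckeF -(tsum_bij shB sF); apply: tsumE.
have h0 := hassumP (summable_hecke_term b1).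
have h1 := hassum_quad_strip b1 0 (d1 l) (dc l).
have h2 := hassum_quad_strip2 b1 0 (d1 (- (2 * t * l))) (dc (- (2 * t * l))).
have := hassumZ (shift_factor l b) (hassumD (hassumD h0 h1) h2).
rewrite !addr0; congr hassum; apply/funext => -[r s].
rewrite /= /hecke_term /= quad_term_shift -/b1 !sg2E /d.
by move: (shift_factor _ _) (quad_term _ _ _) => A B; ring.
Qed.

Variables (a : int) (x : K).
Hypotheses (a0 : 0 <= a) (a2 : a <= 2 * t - 1) (x0 : x != 0).

Definition laurent_term (c : int) (p : int * int) : K :=
  (-1) ^ (p.1 + p.2) * q ^ (binz (p.1 - p.2) + p.2 * c) * x ^ p.1.

Definition cone_term (c : int) (p : int * int) : K :=
  sg2 K (- p.1) p.2 * laurent_term c p.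

Definition four_term (w : (int * int) * (int * int)) : K :=
  cone_term w.2.1 w.1 * hecke_term a w.2.

Lemma four_term_bound : exists u v : int * int -> K,
  [/\ summable u, summable v & forall p w, `|four_term (p, w)| <= `|u p| * `|v
    w|].
Proof.
have [r [r0 r1 qr]] := sqrt_norm_q q0 q1; have [X xX] := norm_exprz r0 r1 x0.
pose C := 4 * ((X%:Z + 2) * (X%:Z + 2)) : int.
pose u (p : int * int) := r ^ (`|p.1| + `|p.2|).
pose v (p : int * int) := r ^ (`|p.1| + `|p.2| - C).
have rz_gt0 z : 0 < r ^ z by rewrite exprz_gt0.
exists u, v; split.
- apply: (@summable_expz2 _ r _ 0 r0 r1) => m n.
  by rewrite subr0 ger0_norm ?(ltW (rz_gt0 _)).
- by apply: (@summable_expz2 _ r _ C r0 r1) => m n;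
  rewrite ger0_norm ?(ltW (rz_gt0 _)).
move=> [n i] [m s]; rewrite /u /v /= !(@gtr0_norm _ (r ^ _))//.
rewrite -expfzDr ?gt_eqF// /four_term /cone_term /hecke_term /=.
suff h : (0 <= - n /\ 0 <= i) \/ (- n <= -1 /\ i <= -1) ->
    (0 <= m /\ 0 <= s) \/ (m <= -1 /\ s <= -1) ->
    `|laurent_term m (n, i) * quad_term a 0 (m, s)| <=
    r ^ (`|n| + `|i| + (`|m| + `|s| - C)).
  case: sg2P => [n0 i0|n0 i0|]; last by rewrite !mul0r normr0 (ltW (rz_gt0 _)).
  - rewrite mul1r; case: sg2P => [m0 s0|m0 s0|];
    last by rewrite mul0r mulr0 normr0 (ltW (rz_gt0 _)).
    + by rewrite mul1r; apply: h; left.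
    + by rewrite mulN1r mulrN normrN; apply: h; [left | right].
  - rewrite mulN1r mulNr normrN; case: sg2P => [m0 s0|m0 s0|];
    last by rewrite mul0r mulr0 normr0 (ltW (rz_gt0 _)).
    + by rewrite mul1r; apply: h; [right | left].
    + by rewrite mulN1r mulrN normrN; apply: h; right.
move=> ni ms.
have -> : laurent_term m (n, i) * quad_term a 0 (m, s) =
    (-1) ^ (n + i + (m + s)) * (q ^ (binz (n - i) + i * m
      + (binz (m + 1) + 2 * t * m * s + binz (s + 1) + a * m)) * x ^ n).
  rewrite /laurent_term /quad_term [in LHS]/= mul0r addr0 (signzD _ (n + i) (m
    + s)) (expfzDr (binz (n - i) + i * m) _ q0).
  by move: (q ^ _) (q ^ _) (x ^ n) => U V W; ring.
rewrite normrM norm_signz mul1r normrM (norm_expz q) qr exprz_exp.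
apply: le_trans (ler_wpM2l _ (xX n)) _; first by exact: ltW.
rewrite -expfzDr ?gt_eqF// ler_exprz//.
exact: quad_bound4.
Qed.

Lemma summable_four_term : summable four_term.
Proof.
have [u [v [su sv uv]]] := four_term_bound.
apply: summable_le (summable_pair su sv) _ => -[p w].
by rewrite [leRHS]normrM; exact: uv.
Qed.

End HeckeSum.

(** * Theta(x) g_a(x) as a Laurent series *)

Section AppellSum.
Variable R : realType.
Local Notation K := R[i].
Variable q : K.
Hypotheses (q0 : q != 0) (q1 : `|q| < 1).

(* Multiplying by x q^c shifts the cone by (1,1), so that only its boundary lines
   i = 0 and n = 1 survive; the latter is a theta series at a power of q. *)
Lemma cone_term_sum (c : int) (x : K) : x != 0 -> summable (cone_term q x c) ->
  (1 - x * q ^ c) * tsum (cone_term q x c) = theta x q.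
Proof.
move=> x0 sV; set S := tsum _; have hV : hassum _ S := hassumP sV.
pose V := laurent_term q x c.
pose U (p : int * int) := sg2 K (1 - p.1) (p.2 - 1) * V p.
pose sh (p : int * int) := (p.1 + 1, p.2 + 1).
have shB : bijective sh.
  by exists (fun p => (p.1 - 1, p.2 - 1)) => -[r s]; rewrite /sh /=;
    congr pair; lia.
have shN (F : int * int -> K) i : (forall j, sh j != i) -> F i = 0.
  by case: i => m n /(_ (m - 1, n - 1)); rewrite /sh /= !subrK eqxx.
have hU : hassum U (x * q ^ c * S).
  apply/(hassum_inj _ (bij_inj shB) (shN _)).
  have := hassumZ (x * q ^ c) hV; congr hassum; apply/funext => -[n i].
  rewrite /U /V /cone_term /laurent_term /sh /=.
  have -> : 1 - (n + 1) = - n by lia.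
  have -> : i + 1 - 1 = i by lia.
  have -> : n + 1 - (i + 1) = n - i by lia.
  rewrite (@signz_even _ (n + 1 + (i + 1)) (n + i) 1); last by lia.
  have -> : q ^ (binz (n - i) + (i + 1) * c) = q ^ (binz (n - i) + i * c) * q ^
    c.
    by rewrite -(expfzDr _ _ q0); congr (q ^ _); ring.
  rewrite (expfzDr n 1 x0) expr1z.
  by move: (q ^ _) (q ^ _) (x ^ n) (sg2 _ _ _) => A B C D; ring.
have h1 : hassum (fun p => (p.2 == 0)%:R * V p) (theta x q).
  have fI : injective (fun n : int => (n, 0 : int)) by move=> ? ? [].
  apply/(hassum_inj _ fI).
    move=> [n i] ni; case: eqVneq => [/= i0|]; last by rewrite mul0r.
    by have := ni n; rewrite i0 eqxx.
  have := hassumP (summable_theta q0 q1 x0); rewrite -jacobi_triple_product//.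
  congr hassum; apply/funext => n.
  by rewrite /V /theta_term /laurent_term /= ?eqxx mul1r mul0r !addr0 ?subr0.
have h2 : hassum (fun p => (p.1 == 1)%:R * V p) 0.
  have fI : injective (fun i : int => (1 : int, i)) by move=> ? ? [].
  apply/(hassum_inj _ fI).
    move=> [n i] ni; case: eqVneq => [/= n1|]; last by rewrite mul0r.
    by have := ni i; rewrite n1 eqxx.
  have qc0 : q ^ c != 0 by exact: expfz_neq0.
  have := hassumP (summable_theta q0 q1 qc0).
  rewrite theta_sum_intpow// => /(hassumZ (- x)); rewrite mulr0.
  congr hassum; apply/funext => i.
  rewrite /V /theta_term /laurent_term /= mul1r exprz_exp signzD !expr1z.
  have -> : binz (1 - i) = binz i by have := binz2 i; have := binz2 (1 - i);
    lia.
  rewrite (expfzDr _ _ q0) [i * c]mulrC.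
  by move: (q ^ _) (q ^ _) => A B; ring.
have : S = x * q ^ c * S + theta x q + (-1) * 0.
  apply: (hassum_unique hV).
  have := hassumD (hassumD hU h1) (hassumZ (-1) h2); congr hassum.
  apply/funext => -[n i]; rewrite /U /cone_term -/V /= !sg2E.
  have -> : (0 <= 1 - n) = (0 <= - n) || (n == 1) by lia.
  have -> : (0 <= i - 1) = (0 <= i) && (i != 0) by lia.
  have [->|n1] := eqVneq n 1; have [->|i0] := eqVneq i 0;
    rewrite ?lexx ?orbF ?andbT /= ?mulr1 ?mulr0 ?mul0r ?mul1r ?addr0; ring.
by move=> E; rewrite mulrBl mul1r {1}E; ring.
Qed.

Variable t : int.
Hypothesis t1 : 1 <= t.

Definition appell_term (a : int) (x : K) (p : int * int) : K :=
  hecke_term q t a p / (1 - x * q ^ p.1).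

Definition appell_laurent (a : int) (x : K) (p : int * int) : K :=
  cone_term q x 0 p * heckeF q t (a + p.2).

Variables (a : int) (x : K).
Hypotheses (a0 : 0 <= a) (a2 : a <= 2 * t - 1) (x0 : x != 0).
Hypothesis xq : forall n : int, x != q ^ n.

Lemma generic_neq0 (n : int) : 1 - x * q ^ n != 0.
Proof.
rewrite subr_eq0; apply: contra (xq (- n)) => /eqP E.
by rewrite -invr_expz -[x](mulfK (expfz_neq0 n q0)) -E mul1r.
Qed.

Let four := @four_term R q t a x.

Lemma four_term_sum_left w : tsum (fun p => four (p, w)) = theta x q *
  appell_term a x w.
Proof.
have sf : summable (fun p => hecke_term q t a w * cone_term q x w.1 p).
  have := summable_inj (_ : injective (fun p : int * int => (p, w)))
    (summable_four_term q0 q1 t1 a0 a2 x0).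
  move=> /(_ _)/summable_le; apply; first by move=> ? ? [].
  by move=> p; rewrite mulrC.
rewrite (_ : (fun p => _) = fun p => hecke_term q t a w * cone_term q x w.1 p);
  last first.
  by apply/funext => p; rewrite mulrC.
rewrite tsumZl// /appell_term; have [->|h0] := eqVneq (hecke_term q t a w) 0.
  by rewrite !mul0r mulr0.
have sc : summable (cone_term q x w.1).
  apply: summable_le (summableZ (hecke_term q t a w)^-1 sf) _ => p.
  by rewrite mulKf.
rewrite -(cone_term_sum x0 sc) mulrC; field; exact: generic_neq0.
Qed.

Lemma four_term_sum_right p : tsum (fun w => four (p, w)) = appell_laurent a x
  p.
Proof.
rewrite /appell_laurent /heckeF -tsumZ; last exact: summable_hecke_term.
congr tsum; apply/funext => -[r s]; case: p => n i.
rewrite /four /four_term /cone_term /laurent_term /hecke_term /quad_term /=.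
rewrite mulr0 addr0 !mul0r !addr0 (expfzDr _ (i * r) q0).
have -> : binz (r + 1) + 2 * t * r * s + binz (s + 1) + (a + i) * r =
  i * r + (binz (r + 1) + 2 * t * r * s + binz (s + 1) + a * r) by ring.
rewrite (expfzDr (i * r) _ q0).
by move: (q ^ _) (q ^ _) (q ^ _) (sg2 _ _ _) => A B C D; ring.
Qed.

Lemma summable_appell_laurent : summable (appell_laurent a x).
Proof.
have [u [v [su sv uv]]] := four_term_bound q0 q1 t1 a0 a2 x0.
have := summable_tsum su sv uv; congr summable; apply/funext => p.
exact: four_term_sum_right.
Qed.

Lemma summable_appell : summable (appell_term a x).
Proof.
have [u [v [su sv uv]]] := four_term_bound q0 q1 t1 a0 a2 x0.
have th0 := theta_neq0 q0 q1 x0 xq.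
have vu w p : `|four ((w, p).2, (w, p).1)| <= `|v w| * `|u p|.
  by rewrite mulrC; exact: uv.
have := summableZ (theta x q)^-1 (summable_tsum (F := fun z => four (z.2, z.1))
  sv su vu).
congr summable; apply/funext => w.
by rewrite (four_term_sum_left w) mulKf.
Qed.

Lemma theta_appell :
  theta x q * tsum (appell_term a x) = tsum (appell_laurent a x).
Proof.
rewrite -(tsumZ _ summable_appell).
have := tsum_swap (summable_four_term q0 q1 t1 a0 a2 x0).
under eq_fun do rewrite four_term_sum_right.
by move=> ->; congr tsum; apply/funext => w; rewrite -four_term_sum_left.
Qed.

End AppellSum.

(** * Dissection modulo 4t^2-1 *)

Section Dissection.
Variable R : realType.
Local Notation K := R[i].
Variable q : K.
Hypotheses (q0 : q != 0) (q1 : `|q| < 1).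
Variables (t m : int).
Hypotheses (t1 : 1 <= t) (m1 : 1 - t <= m) (m2 : m <= t).

Lemma hecke_heckeF b : hecke 1 (2 * t) 1 (q ^ (b + 1)) q q = heckeF q t b.
Proof.
rewrite /hecke /heckeF /tsum; congr usum; apply/funext => -[r s].
rewrite /hecke_term /quad_term /= exprz_exp.
have -> : q ^ (binz (r + 1) + 2 * t * r * s + binz (s + 1) + b * r + 0 * s) =
    q ^ ((b + 1) * r) * q ^ s * q ^ (1 * binz r + 2 * t * r * s + 1 * binz s).
  rewrite -!(expfzDr _ _ q0); congr (q ^ _).
  have := binz2 r; have := binz2 s; have := binz2 (r + 1);
    have := binz2 (s + 1).
  by lia.
by rewrite !mulrA.
Qed.

Definition dilated_hecke (x : K) (k : nat) : K :=
  hecke 1 (4 * t ^+ 2 - 1) (4 * t ^+ 2 * (4 * t ^+ 2 - 1))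
    (x * q ^+ k.+1) (- q ^ (8 * t ^+ 4 - m + 4 * t ^+ 2 * k%:Z)) q.

Definition class_coef (k : nat) : K :=
  (-1) ^+ k.+1 * q ^ (binz (k%:Z + 1) + k%:Z)
  * hecke 1 (2 * t) 1 (q ^ (t - m + 2 - 4 * t ^+ 2 + k%:Z)) q q.

Lemma appell_laurent_class (x : K) (k : nat) (r s : int) : x != 0 ->
  k%:Z < 4 * t ^+ 2 - 1 ->
  appell_laurent q t (t - m) x (- r, k%:Z + (4 * t ^+ 2 - 1) * s) =
  q ^ (1 - m - 2 * t ^+ 2) * class_coef k *
  (sg2 K r s * (-1) ^ (r + s) * (x^-1 * q ^+ k.+1) ^ r
   * (- q ^ (8 * t ^+ 4 - m + 4 * t ^+ 2 * k%:Z)) ^ s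
   * q ^ (1 * binz r + (4 * t ^+ 2 - 1) * r * s
          + 4 * t ^+ 2 * (4 * t ^+ 2 - 1) * binz s)).
Proof.
move=> x0 kN; rewrite /class_coef.
have -> : t - m + 2 - 4 * t ^+ 2 + k%:Z = t - m + 1 - 4 * t ^+ 2 + k%:Z + 1 by
  ring.
rewrite hecke_heckeF /appell_laurent /= (heckeF_shift q0 q1 t1 (s + 1)).
have -> : t - m + (k%:Z + (4 * t ^+ 2 - 1) * s) - (4 * t ^+ 2 - 1) * (s + 1) =
  t - m + 1 - 4 * t ^+ 2 + k%:Z by ring.
rewrite /cone_term /laurent_term /shift_factor /= opprK mulr0 addr0.
have -> : sg2 K r (k%:Z + (4 * t ^+ 2 - 1) * s) = sg2 K r s.
  by rewrite !sg2E; congr (_ + (nat_of_bool _)%:R - _); apply/idP/idP; nia.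
rewrite expNrz expfzMl exprz_inv !exprnP !exprz_exp.
set N := 4 * t ^+ 2 - 1; set Hk := heckeF _ _ _.
have qE : q ^ (binz (- r - (k%:Z + N * s)))
    * q ^ (binz (s + 1 + 1) - 2 * t ^+ 2 * (s + 1) ^+ 2 - t * (s + 1)
        + (t - m + (k%:Z + N * s)) * (s + 1)) =
    q ^ (1 - m - 2 * t ^+ 2) * q ^ (binz (k%:Z + 1) + k%:Z) * q ^ (k.+1%:Z * r)
    * q ^ ((8 * t ^+ 4 - m + 4 * t ^+ 2 * k%:Z) * s)
    * q ^ (1 * binz r + N * r * s + 4 * t ^+ 2 * N * binz s).
  rewrite -!(expfzDr _ _ q0); congr (q ^ _).
  have := binz2 (- r - (k%:Z + N * s)); have := binz2 (s + 1 + 1).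
  have := binz2 (k%:Z + 1); have := binz2 r.
  have : 2 * (4 * t ^+ 2 * N * binz s) = 4 * t ^+ 2 * N * (s * (s - 1)).
    by rewrite -binz2; ring.
  rewrite /N -[k.+1%:Z]/(k.+1 : int) (_ : (k.+1 : int) = k%:Z + 1); last by lia.
  by move: (4 * t ^+ 2 * _ * binz s) => Y; lia.
have sE : (-1) ^ (- r + (k%:Z + N * s)) * (-1) ^ (s + 1) =
    (-1) ^ (k.+1%:Z) * (-1) ^ (r + s) * (-1) ^ s :> K.
  rewrite -!signzD; apply: (@signz_even _ _ _ (- r + 2 * t ^+ 2 * s - s));
    rewrite /N; lia.
transitivity (sg2 K r s * ((-1) ^ (- r + (k%:Z + N * s)) * (-1) ^ (s + 1))
  * (q ^ (binz (- r - (k%:Z + N * s)))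
    * q ^ (binz (s + 1 + 1) - 2 * t ^+ 2 * (s + 1) ^+ 2 - t * (s + 1)
        + (t - m + (k%:Z + N * s)) * (s + 1))) * x ^ (- r) * Hk).
  set A := q ^ _; set B := q ^ _; set U := x ^ _; set V := (-1) ^ _;
    set V' := (-1) ^ _.
  by ring.
rewrite qE sE.
set A := q ^ _; set B := q ^ _; set C := q ^ _; set D := q ^ _; set E := q ^ _.
set U := x ^ _; set V := (-1) ^ _; set V' := (-1) ^ _; set V'' := (-1) ^ _.
by ring.
Qed.

Lemma tsum_appell_laurent (x : K) : x != 0 ->
  summable (appell_laurent q t (t - m) x) ->
  tsum (appell_laurent q t (t - m) x) = q ^ (1 - m - 2 * t ^+ 2) *
    \sum_(0 <= k < absz (4 * t ^+ 2 - 1)%R) class_coef k * dilated_hecke x^-1 k.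
Proof.
move=> x0 sL; set N := absz _.
have NE : N%:Z = 4 * t ^+ 2 - 1 by rewrite /N gez0_abs//; nia.
pose e (z : 'I_N * (int * int)) := (- z.2.1, (z.1 : nat)%:Z + (4 * t ^+ 2 - 1)
  * z.2.2).
have eI : injective e.
  move=> [k [r s]] [k' [r' s']] []/= rr kk.
  have -> : r = r' by lia.
  have kN := ltn_ord k; have kN' := ltn_ord k'.
  have ss : s = s' by rewrite -NE in kk; nia.
  by subst s'; have -> : k = k' by apply/val_inj => /=; lia.
have eS (F : int * int -> K) p : (forall j, e j != p) -> F p = 0.
  case: p => n i ne.
  have kN : (`|(i %% N)%Z| < N)%N.
    by have := @modz_ge0 i N; have := @ltz_pmod i N; lia.
  have := ne (Ordinal kN, (- n, (i %/ N)%Z)); rewrite /e /= opprK -NE.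
  have -> : (`|(i %% N)%Z|%N : int) + N%:Z * (i %/ N)%Z = i.
    by have := @modz_ge0 i N; have := divz_eq i N; lia.
  by rewrite eqxx.
rewrite -(tsum_inj eI sL (eS _)).
have sLe := summable_inj eI sL.
rewrite -(tsum_pair sLe) tsum_fin big_mkord mulr_sumr; apply: eq_bigr => k _.
pose Hk (p : int * int) := let: (r, s) := p in
  sg2 K r s * (-1) ^ (r + s) * (x^-1 * q ^+ k.+1) ^ r
   * (- q ^ (8 * t ^+ 4 - m + 4 * t ^+ 2 * k%:Z)) ^ s
   * q ^ (1 * binz r + (4 * t ^+ 2 - 1) * r * s
          + 4 * t ^+ 2 * (4 * t ^+ 2 - 1) * binz s).
have E : (fun p => (appell_laurent q t (t - m) x \o e) (k, p)) =
    (fun p => q ^ (1 - m - 2 * t ^+ 2) * class_coef k * Hk p).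
  apply/funext => -[r s]; rewrite /= /e /= appell_laurent_class// -NE.
  by have := ltn_ord k; lia.
have sH : summable (fun p => q ^ (1 - m - 2 * t ^+ 2) * class_coef k * Hk p).
  by rewrite -E; exact: summable_row sLe.
have -> : dilated_hecke x^-1 k = tsum Hk by [].
by rewrite E (tsumZl sH) -mulrA.
Qed.

(* On the line r = 0 the substitution exchanges s >= 0 and s < 0 without changing
   sg r; the discrepancy is a full theta series, hence 0. *)
Lemma appell_inv (x : K) : x != 0 -> x != 1 ->
  summable (appell_term q t (t - m) x^-1) ->
  (forall n : int, 1 - x * q ^ n != 0) ->
  summable (appell_term q t (t + m) x) /\
  tsum (appell_term q t (t + m) x) =
    - x^-1 * tsum (appell_term q t (t - m) x^-1).
Proof.
move=> x0 x1 sA xq.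
pose sh (p : int * int) := (- p.1, - 1 - p.2).
have shK : involutive sh by move=> [r s]; rewrite /sh /=; congr pair; lia.
have shB : bijective sh by exists sh.
pose d (r : int) : K := (r == 0)%:R.
have d1 r : `|d r| <= 1 by rewrite /d; case: eqP; rewrite ?normr1 ?normr0.
have dc r : 0 < `|r| -> d r = 0 by rewrite /d; case: eqP => // ->.
pose G p := - x^-1 * appell_term q t (t - m) x^-1 p
  + (x^-1 / (1 - x^-1)) * (d p.1 * quad_term q t (t - m) 0 p).
have GE : appell_term q t (t + m) x \o sh = G.
  apply/funext => -[r s]; rewrite /G /appell_term /hecke_term /sh /=.
  have -> : quad_term q t (t + m) 0 (- r, - 1 - s) =
      - (quad_term q t (t - m) 0 (r, s) * q ^ (- r)).
    rewrite /quad_term /= (@signz_even _ _ (1 + (r + s)) (- 1 - r - s));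
      last by lia.
    have -> : q ^ (binz (- r + 1) + 2 * t * - r * (- 1 - s) + binz (- 1 - s + 1)
        + (t + m) * - r + 0 * (- 1 - s)) =
      q ^ (binz (r + 1) + 2 * t * r * s + binz (s + 1) + (t - m) * r + 0 * s) *
        q ^ (- r).
      rewrite -(expfzDr _ _ q0); congr (q ^ _).
      have := binz2 (- r + 1); have := binz2 (- 1 - s + 1).
      by have := binz2 (r + 1); have := binz2 (s + 1); lia.
    rewrite (signzD _ 1 (r + s)) expr1z.
    by move: (q ^ _) (q ^ _) => A B; ring.
  have -> : sg2 K (- r) (- 1 - s) = - sg2 K r s + d r.
    rewrite !sg2E /d; have -> : (0 <= - r) = ~~ (0 <= r) || (r == 0) by lia.
    have -> : (0 <= - 1 - s) = ~~ (0 <= s) by lia.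
    by have [->|_] := eqVneq r 0; rewrite ?lexx; case: (0 <= r);
      case: (0 <= s); rewrite /=; ring.
  have qr0 : q ^ r != 0 by exact: expfz_neq0.
  have xy : x - q ^ r != 0.
    apply: contra (xq (- r)); rewrite subr_eq0 => /eqP ->.
    by rewrite -invr_expz mulfV// subrr.
  have x1' : x - 1 != 0 by rewrite subr_eq0.
  have E : q ^ (- r) / (1 - x * q ^ (- r)) = - x^-1 / (1 - x^-1 * q ^ r).
    by rewrite -invr_expz; field; rewrite x0 qr0 xy -opprB oppr_eq0 xy.
  have E' : d r * (x^-1 / (1 - x^-1 * q ^ r)) = d r * (x^-1 / (1 - x^-1)).
    by rewrite /d; have [->|] := eqVneq r 0; rewrite ?mul0r// expr0z mulr1.
  set Q := quad_term _ _ _ _ _.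
  transitivity ((sg2 K r s - d r) * Q * (q ^ (- r) / (1 - x * q ^ (- r))));
    first by ring.
  rewrite E; transitivity (- x^-1 * (sg2 K r s * Q / (1 - x^-1 * q ^ r))
    + d r * (x^-1 / (1 - x^-1 * q ^ r)) * Q); first by ring.
  by rewrite E'; ring.
have sT := summable_quad_strip q0 q1 t1 (t - m) 0 d1 dc.
have sG : summable G by apply: summableD; exact: summableZ.
have hG : hassum G (- x^-1 * tsum (appell_term q t (t - m) x^-1)).
  have hT := hassum_quad_strip q0 q1 t1 (t - m) 0 d1 dc.
  have := hassumD (hassumZ (- x^-1) (hassumP sA)) (hassumZ (x^-1 / (1 - x^-1))
    hT).
  by rewrite mulr0 addr0.
split.
  have := summable_inj (bij_inj shB) sG; congr summable; apply/funext => p.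
  by rewrite -GE /= shK.
apply: tsumE; apply/(hassum_inj _ (bij_inj shB)); last by rewrite GE.
by move=> p /(_ (sh p)); rewrite shK eqxx.
Qed.

Lemma h_appell (x : K) : summable (appell_term q t (t - m) x) ->
  summable (appell_term q t (t + m) x) ->
  h t m x q = tsum (appell_term q t (t - m) x) + tsum (appell_term q t (t + m)
    x).
Proof.
move=> s1 s2; pose G p := appell_term q t (t - m) x p + appell_term q t (t + m)
  x p.
have sG : summable G := summableD s1 s2.
have GE p : G p = sg2 K p.1 p.2 * h_term t m x q p.
  case: p => r s; rewrite /G /appell_term /hecke_term /quad_term /h_term /=.
  have -> : q ^ (binz (r + 1) + 2 * t * r * s + binz (s + 1) + (t + m) * r + 0
    * s) =
    q ^ (binz (r + 1) + 2 * t * r * s + binz (s + 1) + (t - m) * r) * q ^ (2 *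
      m * r).
    by rewrite -(expfzDr _ _ q0); congr (q ^ _); ring.
  rewrite mul0r addr0; move: (q ^ (binz _ + _ + _ + _)) (q ^ (2 * m * r)) => A
    B.
  by ring.
pose F1 (p : int * int) := if (0 <= p.1) && (0 <= p.2) then h_term t m x q p
  else 0.
pose F2 (p : int * int) := if (p.1 < 0) && (p.2 < 0) then h_term t m x q p else
  0.
have F1E p : F1 p = if (0 <= p.1) && (0 <= p.2) then G p else 0.
  rewrite /F1 GE sg2E; case: (0 <= p.1); case: (0 <= p.2) => //=.
  by rewrite addrK mul1r.
have F2E p : F2 p = if (p.1 < 0) && (p.2 < 0) then - G p else 0.
  rewrite /F2 GE sg2E !ltNge; case: (0 <= p.1); case: (0 <= p.2) => //=.
  by rewrite add0r sub0r mulN1r opprK.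
have sF1 : summable F1.
  by apply: summable_le sG _ => p; rewrite F1E; case: ifP => // _;
    rewrite normr0.
have sF2 : summable F2.
  by apply: summable_le sG _ => p; rewrite F2E; case: ifP => // _;
    rewrite ?normr0 ?normrN.
rewrite /h (hassum_usum (hassumP sF1)) (hassum_usum (hassumP sF2)).
rewrite -(tsumD s1 s2) -/(tsum G) -[X in _ - X]mul1r -mulNr -(tsumZ _ sF2).
rewrite -(tsumD sF1 (summableZ _ sF2)); congr tsum; apply/funext => p.
rewrite F1E F2E -/(G p) !ltNge.
have : (0 <= p.1) != (0 <= p.2) -> G p = 0.
  by rewrite GE sg2E; case: (0 <= p.1); case: (0 <= p.2) => //= _;
    rewrite ?addr0 ?add0r subrr mul0r.
case: (0 <= p.1); case: (0 <= p.2) => /= Gp;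
  rewrite ?mulr0 ?addr0 ?add0r ?mulN1r ?opprK//.
- by rewrite Gp.
- by rewrite Gp.
Qed.

Lemma theta_h (x : K) : x != 0 -> (forall n : int, x != q ^ n) ->
  theta x q * h t m x q = q ^ (1 - m - 2 * t ^+ 2) *
    \sum_(0 <= k < absz (4 * t ^+ 2 - 1)%R)
      class_coef k * (dilated_hecke x^-1 k + dilated_hecke x k).
Proof.
move=> x0 xq; have a0 : 0 <= t - m by lia.
have a2 : t - m <= 2 * t - 1 by lia.
have x0' : x^-1 != 0 by rewrite invr_eq0.
have xq' n : x^-1 != q ^ n.
  by apply: contra (xq (- n)) => /eqP E; rewrite -invr_expz -E invrK.
have sA := summable_appell q0 q1 t1 a0 a2 x0 xq.
have sA' := summable_appell q0 q1 t1 a0 a2 x0' xq'.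
have [|sB E] := appell_inv x0 _ sA' (fun n => generic_neq0 q0 xq n).
  by have := xq 0; rewrite expr0z.
rewrite h_appell// mulrDr E theta_appell// tsum_appell_laurent//;
  last exact: summable_appell_laurent.
have -> : theta x q * (- x^-1 * tsum (appell_term q t (t - m) x^-1)) =
    theta x^-1 q * tsum (appell_term q t (t - m) x^-1).
  by rewrite !jacobi_triple_product// theta_sum_inv//; ring.
rewrite theta_appell// tsum_appell_laurent//;
  last exact: summable_appell_laurent.
rewrite invrK -mulrDr -big_split/=; congr (_ * _).
by apply: eq_bigr => k _; rewrite mulrDr.
Qed.

End Dissection.

Theorem theorem1p2 (R : realType) (q : R[i]) (t m : int) (x : R[i])
    (q_neq0 : q != 0) (q_lt1 : `|q| < 1)
    (t_ge1 : 1 <= t) (m_ge : 1 - t <= m) (m_le : m <= t)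
    (x_neq0 : x != 0) (x_generic : forall n : int, x != q ^ n) :
  W t m x q =
    (1 - x) * q ^ (1 - m - 2 * t ^+ 2) / (qpochoo q q ^+ 2 * theta x q)
    * (\sum_(0 <= k < absz (4 * t ^+ 2 - 1)%R)
         (-1) ^+ k.+1 * q ^ (binz (k%:Z + 1) + k%:Z)
         * hecke 1 (2 * t) 1
             (q ^ (t - m + 2 - 4 * t ^+ 2 + k%:Z)) q q
         * (hecke 1 (4 * t ^+ 2 - 1) (4 * t ^+ 2 * (4 * t ^+ 2 - 1))
              (x^-1 * q ^+ k.+1)
              (- q ^ (8 * t ^+ 4 - m + 4 * t ^+ 2 * k%:Z)) q
            + hecke 1 (4 * t ^+ 2 - 1) (4 * t ^+ 2 * (4 * t ^+ 2 - 1))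
                (x * q ^+ k.+1)
                (- q ^ (8 * t ^+ 4 - m + 4 * t ^+ 2 * k%:Z)) q))
    - 1 / (qpochoo (x * q) q * qpochoo (q / x) q).
Proof.
rewrite /W; congr (_ - _); set S := \sum_(0 <= k < _) _.
have th0 := theta_neq0 q_neq0 q_lt1 x_neq0 x_generic.
have E : theta x q * h t m x q = q ^ (1 - m - 2 * t ^+ 2) * S.
  exact: theta_h.
rewrite -[h t m x q](mulKf th0) E [in RHS]invfM.
move: (theta x q)^-1 (qpochoo q q ^+ 2)^-1 (q ^ _) => A B C.
by ring.
Qed.
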